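(* $$\left((B_4(\mathbb{D}^2))^{(3)}\right)^{\mathrm{Ab}}=(B_4(\mathbb{D}^2))^{(3)}/(B_4(\mathbb{D}^2))^{(4)}\cong\mathbb{Z}^3\times\mathbb{Z}_{18}\times\mathbb{Z}_{18}\times(\mathbb{F}_2(u,v))^{(2)}/(\mathbb{F}_2(u,v))^{(3)},$$ where $\mathbb{F}_2(u,v)$ is the free group of rank $2$ on $u,v$.
   Context: $\mathbb{D}^2$ is the closed $2$-disc and $B_4(\mathbb{D}^2)$ is Artin's $4$-string braid group, generated by $\sigma_1,\sigma_2,\sigma_3$ subject to $\sigma_1\sigma_3=\sigma_3\sigma_1$ and $\sigma_i\sigma_{i+1}\sigma_i=\sigma_{i+1}\sigma_i\sigma_{i+1}$ for $i=1,2$. Derived series: $G^{(0)}=G$, $G^{(i)}=[G^{(i-1)},G^{(i-1)}]$; $G^{\mathrm{Ab}}=G/[G,G]$. $\mathbb{Z}_{18}$ is the cyclic group of order $18$. *)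

(* Defs.v *)
(* Possibly infinite groups are MathComp's [groupType]s, and subgroups are
   boolean predicates; boolp makes generated subgroups boolean.               *)
From HB Require Import structures.
From Stdlib Require Import Relation_Operators.
From mathcomp Require Import all_boot all_algebra.
From mathcomp Require Import boolp.

Set Implicit Arguments.
Unset Strict Implicit.
Unset Printing Implicit Defensive.

Local Open Scope group_scope.
Local Open Scope quotient_scope.

HB.mixin Record isConjClosed (G : groupType) (N : {pred G}) := {
  gpredJr : forall x y : G, x \in N -> x ^ y \in N
}.

#[short(type="normalClosed")]
HB.structure Definition NormalClosed (G : groupType) :=
  {N of isConjClosed G N & GroupClosed G N}.

Section FullGroup.
Variable G : groupType.

Definition full : {pred G} := xpredT.

Fact full_mulg_closed : mulg_closed full. Proof. by []. Qed.
Fact full_1 : 1 \in full. Proof. by []. Qed.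
Fact full_invg_closed : invg_closed full. Proof. by []. Qed.
Fact full_conj (x y : G) : x \in full -> x ^ y \in full. Proof. by []. Qed.

HB.instance Definition _ := isMulClosed.Build G full full_mulg_closed.
HB.instance Definition _ := isMul1Closed.Build G full full_1.
HB.instance Definition _ := isInvClosed.Build G full full_invg_closed.
HB.instance Definition _ := isConjClosed.Build G full full_conj.

End FullGroup.
Arguments full G : clear implicits.

Section SubgroupType.
Variables (G : groupType) (H : groupClosed G).

Definition subgroup_type := {x : G | x \in H}.

HB.instance Definition _ := SubChoice.on subgroup_type.

Fact subgroup_type_closed : group_closed (fun x : G => x \in H).
Proof. by split; [exact: gpred1 | move=> x y; exact: gpredF]. Qed.

HB.instance Definition _ :=
  SubChoice_isSubGroup.Build G _ subgroup_type subgroup_type_closed.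

End SubgroupType.

Section Quotient.
Variables (G : groupType) (N : normalClosed G).

Definition coset_rel (x y : G) := x^-1 * y \in N.

Fact coset_rel_refl : reflexive coset_rel.
Proof. by move=> x; rewrite /coset_rel mulVg gpred1. Qed.

Fact coset_rel_sym : symmetric coset_rel.
Proof. by move=> x y; rewrite /coset_rel -(gpredV N) invgM invgK. Qed.

Fact coset_rel_trans : transitive coset_rel.
Proof.
move=> y x z; rewrite /coset_rel => xy yz.
by have := gpredM _ _ xy yz; rewrite mulgA mulgK.
Qed.

Canonical coset_equiv :=
  EquivRel coset_rel coset_rel_refl coset_rel_sym coset_rel_trans.

Definition quotient_group := {eq_quot coset_equiv}.

HB.instance Definition _ := Choice.on quotient_group.
HB.instance Definition _ := EqQuotient.on quotient_group.

Definition coset (x : G) : quotient_group := \pi_quotient_group x.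

Lemma coset_eqP x y : reflect (coset x = coset y) (x^-1 * y \in N).
Proof. exact: (@eqquotP _ _ quotient_group x y). Qed.

Definition quotient_mul (a b : quotient_group) : quotient_group :=
  coset (repr a * repr b).
Definition quotient_inv (a : quotient_group) : quotient_group :=
  coset (repr a)^-1.

Lemma reprK_coset a : coset (repr a) = a. Proof. exact: reprK. Qed.

Lemma quotient_mulE x y : quotient_mul (coset x) (coset y) = coset (x * y).
Proof.
have /coset_eqP xN := reprK_coset (coset x).
have /coset_eqP yN := reprK_coset (coset y).
rewrite /quotient_mul; apply/coset_eqP.
set x' := repr _ in xN *; set y' := repr _ in yN *.
have -> : (x' * y')^-1 * (x * y) = (x'^-1 * x) ^ y' * (y'^-1 * y).
  by rewrite invgM /conjg -!mulgA mulVKg.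
by rewrite gpredM// gpredJr.
Qed.

Lemma quotient_invE x : quotient_inv (coset x) = coset x^-1.
Proof.
have /coset_eqP xN := reprK_coset (coset x).
rewrite /quotient_inv; apply/coset_eqP.
set x' := repr _ in xN *.
have -> : x'^-1^-1 * x^-1 = ((x'^-1 * x) ^ x^-1)^-1 ^ 1.
  by rewrite conjg1 /conjg invgK -!mulgA mulgV mulg1 invgM !invgK.
by rewrite gpredJr// gpredV gpredJr.
Qed.

Fact quotient_mulA : associative quotient_mul.
Proof.
move=> a b c; rewrite -(reprK_coset a) -(reprK_coset b) -(reprK_coset c).
by rewrite !quotient_mulE mulgA.
Qed.

Fact quotient_mul1 : left_id (coset 1) quotient_mul.
Proof. by move=> a; rewrite -(reprK_coset a) quotient_mulE mul1g. Qed.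

Fact quotient_1mul : right_id (coset 1) quotient_mul.
Proof. by move=> a; rewrite -(reprK_coset a) quotient_mulE mulg1. Qed.

Fact quotient_mulV : left_inverse (coset 1) quotient_inv quotient_mul.
Proof.
by move=> a; rewrite -(reprK_coset a) quotient_invE quotient_mulE mulVg.
Qed.

Fact quotient_Vmul : right_inverse (coset 1) quotient_inv quotient_mul.
Proof.
by move=> a; rewrite -(reprK_coset a) quotient_invE quotient_mulE mulgV.
Qed.

HB.instance Definition _ := isGroup.Build quotient_group
  quotient_mulA quotient_mul1 quotient_1mul quotient_mulV quotient_Vmul.

End Quotient.
Arguments coset {G} N x.

Section Generated.
Variables (G : groupType) (A : G -> Prop).

Definition generated : {pred G} := fun x =>
  `[< forall H : groupClosed G, (forall a, A a -> a \in H) -> x \in H >].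

Lemma generatedP x :
  reflect (forall H : groupClosed G, (forall a, A a -> a \in H) -> x \in H)
          (x \in generated).
Proof. exact: asboolP. Qed.

Lemma mem_generated x : A x -> x \in generated.
Proof. by move=> Ax; apply/generatedP => H; apply. Qed.

Fact generated_1 : 1 \in generated.
Proof. by apply/generatedP => H _; exact: gpred1. Qed.

Fact generated_mul : mulg_closed generated.
Proof.
move=> x y /generatedP xA /generatedP yA; apply/generatedP => H AH.
by rewrite gpredM ?xA ?yA.
Qed.

Fact generated_inv : invg_closed generated.
Proof.
by move=> x /generatedP xA; apply/generatedP => H AH; rewrite gpredV xA.
Qed.

HB.instance Definition _ := isMulClosed.Build G generated generated_mul.
HB.instance Definition _ := isMul1Closed.Build G generated generated_1.
HB.instance Definition _ := isInvClosed.Build G generated generated_inv.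

End Generated.

Section Preimage.
Variables (G K : groupType) (f : UMagmaMorphism.type G K).

Definition preimage (H : {pred K}) : {pred G} := fun x => f x \in H.

Lemma mem_preimage H x : (x \in preimage H) = (f x \in H). Proof. by []. Qed.

Section Group.
Variable H : groupClosed K.

Fact preimage_1 : 1 \in preimage H.
Proof. by rewrite mem_preimage gmulf1 gpred1. Qed.
Fact preimage_mul : mulg_closed (preimage H).
Proof. by move=> x y; rewrite !mem_preimage gmulfM; exact: gpredM. Qed.
Fact preimage_inv : invg_closed (preimage H).
Proof. by move=> x; rewrite !mem_preimage gmulfV gpredV. Qed.

HB.instance Definition _ := isMulClosed.Build G (preimage H) preimage_mul.
HB.instance Definition _ := isMul1Closed.Build G (preimage H) preimage_1.
HB.instance Definition _ := isInvClosed.Build G (preimage H) preimage_inv.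
End Group.

Fact preimage_conj (N : normalClosed K) (x y : G) :
  x \in preimage N -> x ^ y \in preimage N.
Proof. by rewrite !mem_preimage gmulfJ; exact: gpredJr. Qed.

HB.instance Definition _ (N : normalClosed K) :=
  isConjClosed.Build G (preimage N) (@preimage_conj N).

End Preimage.

Section Conjugation.
Variables (G : groupType) (y : G).

Definition conj_by (x : G) := x ^ y.

Fact conj_by_morphism (a b : G) : conj_by (a / b) = conj_by a / conj_by b.
Proof. by rewrite /conj_by conjMg conjVg. Qed.

HB.instance Definition _ := isGroupMorphism.Build G G conj_by conj_by_morphism.

End Conjugation.

Section Commutator.
Variable G : groupType.

Definition commutator (A B : {pred G}) : {pred G} :=
  generated (fun z => exists x y, [/\ x \in A, y \in B & z = [~ x, y]]).

HB.instance Definition _ (A B : {pred G}) :=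
  GroupClosed.copy (commutator A B) (generated _).

Fact commutator_conj (A B : normalClosed G) (x y : G) :
  x \in commutator A B -> x ^ y \in commutator A B.
Proof.
move=> /generatedP xAB; apply: (xAB (preimage (conj_by y) (commutator A B))).
move=> _ [a [b [aA bB ->]]]; rewrite mem_preimage /= /conj_by conjRg; apply: mem_generated.
by exists (a ^ y), (b ^ y); rewrite !gpredJr.
Qed.

HB.instance Definition _ (A B : normalClosed G) :=
  isConjClosed.Build G (commutator A B) (@commutator_conj A B).

Fixpoint derived_series (n : nat) : normalClosed G :=
  if n is n'.+1 then commutator (derived_series n') (derived_series n')
  else full G.

Lemma derived_series_sub n :
  {subset derived_series n.+1 <= derived_series n}.
Proof.
move=> z /generatedP; apply=> _ [x [y [xn yn ->]]].
by rewrite gpredM ?gpredV ?gpredJr.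
Qed.

Definition abelianization : groupType :=
  quotient_group (commutator (full G) (full G)).

Definition abelianization_proj (x : G) : abelianization :=
  coset (commutator (full G) (full G)) x.

(* H / (H :&: N), i.e. H / N whenever N is contained in H *)
Definition section_group (H : groupClosed G) (N : normalClosed G) : groupType :=
  quotient_group (preimage (val : subgroup_type H -> G) N).

Definition section_proj (H : groupClosed G) (N : normalClosed G)
    (x : subgroup_type H) : section_group H N :=
  coset (preimage (val : subgroup_type H -> G) N) x.

End Commutator.
Arguments section_proj {G} H N x.

Section Isomorphism.
Variables G H : groupType.

Definition isomorphic : Prop :=
  exists f : {multiplicative G -> H}, bijective f.

End Isomorphism.

Section FreeGroup.
Variable I : choiceType.

(* The letter (i, true) stands for the generator i, (i, false) for its inverse. *)
Definition word := seq (I * bool).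

Inductive cancellation : word -> word -> Prop :=
  Cancellation (u v : word) (i : I) (b : bool) :
    cancellation (u ++ [:: (i, b); (i, ~~ b)] ++ v) (u ++ v).

Definition word_rel (u v : word) := `[< clos_refl_sym_trans _ cancellation u v >].

Lemma word_relP u v :
  reflect (clos_refl_sym_trans _ cancellation u v) (word_rel u v).
Proof. exact: asboolP. Qed.

Fact word_rel_refl : reflexive word_rel.
Proof. by move=> u; apply/word_relP; exact: rst_refl. Qed.

Fact word_rel_sym : symmetric word_rel.
Proof. by move=> u v; apply/word_relP/word_relP; exact: rst_sym. Qed.

Fact word_rel_trans : transitive word_rel.
Proof.
move=> v u w /word_relP uv /word_relP vw; apply/word_relP.
exact: rst_trans uv vw.
Qed.

Canonical word_equiv :=
  EquivRel word_rel word_rel_refl word_rel_sym word_rel_trans.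

Definition free_group := {eq_quot word_equiv}.

HB.instance Definition _ := Choice.on free_group.
HB.instance Definition _ := EqQuotient.on free_group.

Definition word_class (u : word) : free_group := \pi_free_group u.

Lemma word_classP u v : reflect (word_class u = word_class v) (word_rel u v).
Proof. exact: (@eqquotP _ _ free_group u v). Qed.

Definition word_inv (u : word) : word := rev [seq (x.1, ~~ x.2) | x <- u].

Definition free_mul (a b : free_group) : free_group :=
  word_class (repr a ++ repr b).
Definition free_inv (a : free_group) : free_group :=
  word_class (word_inv (repr a)).
Definition free_gen (i : I) : free_group := word_class [:: (i, true)].

Lemma repr_word_class a : word_class (repr a) = a. Proof. exact: reprK. Qed.

Lemma word_rel_map (f : word -> word) :
  (forall u v, cancellation u v -> word_rel (f u) (f v)) ->
  forall u v, word_rel u v -> word_rel (f u) (f v).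
Proof.
move=> fP u v /word_relP; elim=> {u v} [u v /fP //|u|u v _|u v w _ fuv _].
- exact: word_rel_refl.
- by rewrite word_rel_sym.
- exact: word_rel_trans fuv.
Qed.

Lemma word_rel_cat u u' v v' :
  word_rel u u' -> word_rel v v' -> word_rel (u ++ v) (u' ++ v').
Proof.
move=> uu' vv'; apply: (@word_rel_trans (u' ++ v)).
  apply: (@word_rel_map (cat^~ v)) uu' => _ _ [x y i b] /=.
  by apply/word_relP; apply: rst_step; rewrite -!catA; exact: Cancellation.
apply: (@word_rel_map (cat u')) vv' => _ _ [x y i b].
by apply/word_relP; apply: rst_step; rewrite !(catA u'); exact: Cancellation.
Qed.

Lemma word_inv_cat u v : word_inv (u ++ v) = word_inv v ++ word_inv u.
Proof. by rewrite /word_inv map_cat rev_cat. Qed.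

Lemma word_invK : involutive word_inv.
Proof.
move=> u; rewrite /word_inv map_rev revK -map_comp.
by rewrite -[RHS]map_id; apply: eq_map => -[i b] /=; rewrite negbK.
Qed.

Lemma word_rel_inv u v : word_rel u v -> word_rel (word_inv u) (word_inv v).
Proof.
apply: word_rel_map => _ _ [x y i b]; apply/word_relP; apply: rst_step.
rewrite !word_inv_cat -catA.
by have := Cancellation (word_inv y) (word_inv x) i b; rewrite /= -{1}[b]negbK.
Qed.

Lemma free_mulE u v :
  free_mul (word_class u) (word_class v) = word_class (u ++ v).
Proof. by apply/word_classP/word_rel_cat; apply/word_classP/repr_word_class. Qed.

Lemma free_invE u : free_inv (word_class u) = word_class (word_inv u).
Proof. by apply/word_classP/word_rel_inv; apply/word_classP/repr_word_class. Qed.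

Fact free_mulA : associative free_mul.
Proof.
move=> a b c; rewrite -(repr_word_class a) -(repr_word_class b).
by rewrite -(repr_word_class c) !free_mulE catA.
Qed.

Fact free_mul1 : left_id (word_class [::]) free_mul.
Proof. by move=> a; rewrite -(repr_word_class a) free_mulE. Qed.

Fact free_1mul : right_id (word_class [::]) free_mul.
Proof. by move=> a; rewrite -(repr_word_class a) free_mulE cats0. Qed.

Lemma word_rel_mulV u : word_rel (u ++ word_inv u) [::].
Proof.
elim/last_ind: u => [|u [i b] IHu]; first exact: word_rel_refl.
rewrite -cats1 word_inv_cat /= -catA; apply: word_rel_trans IHu.
by apply/word_relP; apply: rst_step; exact: Cancellation.
Qed.

Fact free_Vmul : right_inverse (word_class [::]) free_inv free_mul.
Proof.
move=> a; rewrite -(repr_word_class a) free_invE free_mulE.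
by apply/word_classP/word_rel_mulV.
Qed.

Fact free_mulV : left_inverse (word_class [::]) free_inv free_mul.
Proof.
move=> a; rewrite -(repr_word_class a) free_invE free_mulE.
by apply/word_classP; rewrite -{2}[repr a]word_invK; exact: word_rel_mulV.
Qed.

HB.instance Definition _ := isGroup.Build free_group
  free_mulA free_mul1 free_1mul free_mulV free_Vmul.

End FreeGroup.

Section NormalClosure.
Variables (G : groupType) (A : G -> Prop).

Definition normal_closure : {pred G} :=
  generated (fun z => exists x y, A x /\ z = x ^ y).

HB.instance Definition _ := GroupClosed.copy normal_closure (generated _).

Fact normal_closure_conj (x y : G) :
  x \in normal_closure -> x ^ y \in normal_closure.
Proof.
move=> /generatedP xA; apply: (xA (preimage (conj_by y) normal_closure)).
move=> _ [a [b [Aa ->]]]; rewrite mem_preimage /= /conj_by -conjgM.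
by apply: mem_generated; exists a, (b * y).
Qed.

HB.instance Definition _ := isConjClosed.Build G normal_closure normal_closure_conj.

End NormalClosure.

Definition presented_group (I : choiceType) (R : free_group I -> Prop) : groupType :=
  quotient_group (normal_closure R).

(* The index i : 'I_n.-1 stands for the Artin generator sigma_(i+1). *)
Inductive braid_relator (n : nat) : free_group 'I_n.-1 -> Prop :=
| braid_far (i j : 'I_n.-1) of (i.+1 < j)%N :
    braid_relator (free_gen i * free_gen j / (free_gen j * free_gen i))
| braid_near (i j : 'I_n.-1) of j = i.+1 :> nat :
    braid_relator (free_gen i * free_gen j * free_gen i
                   / (free_gen j * free_gen i * free_gen j)).

Definition braid_group (n : nat) : groupType := presented_group (@braid_relator n).

(* Main.v *)
(* Put a = s3 s1^-1, b = s2 a s2^-1, u = s2 s1^-1 and v = s1 u s1^-1. The group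
   N = <a, b> is normal in B_4, F = <u, v> is free, and B_4' = F N. Since N / N'
   has no nonzero coinvariants under F, B_4'' = F' N; the coinvariants of N / N'
   under F' are N / K, where K is generated by the squares of N, so that
   B_4''' = F'' K and B_4'''/B_4'''' is the product of F''/F''' and of the
   coinvariants of K / K' = Z^5 under F''. Let p : Z^5 -> Z^2 be half of the map
   from K / K' to N / N' = Z^2, and t : Z^2 -> Z^5 the transfer. Every element of
   F' acts on Z^5 as x |-> x + t (W (p x)) for an integer matrix W congruent to 0
   or -1 modulo 3. Since p t = 2, the commutator of two such maps moves x by
   2 t [W, W'] p x up to the choice of x, hence by an element of 18 t(Z^2); two
   conjugates of [u, v] already realize all of 18 t(Z^2). As t(Z^2) is a direct
   summand of Z^5, the coinvariants are Z^3 x Z_18 x Z_18.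
   That elements lie in B_4'''' is shown by word computations in B_4 / B_4''''.
   That others do not is detected by two actions of B_4: on F, where N acts
   trivially, and on N / K' with Z^5 replaced by Z^5 / 18 t(Z^2). *)
From HB Require Import structures.
From Stdlib Require Import Relation_Operators.
Require Import Defs.
From mathcomp Require Import all_boot all_algebra.
From mathcomp Require Import ring.
From mathcomp Require Import boolp.

Set Implicit Arguments.
Unset Strict Implicit.
Unset Printing Implicit Defensive.

Import GRing.Theory.
Local Open Scope group_scope.

(** * Subgroups, quotients and words *)

Notation ghom := UMagmaMorphism.type.

Lemma hom_of_morph (G H : groupType) (f : G -> H) :
  {morph f : x y / x * y} -> exists phi : ghom G H, phi =1 f.
Proof.
move=> fM; have f1 : f 1 = 1 by apply: (mulgI (f 1)); rewrite -fM !mulg1.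
pose m := isUMagmaMorphism.Build G H f (conj f1 fM).
pose phi : ghom G H := HB.pack f m.
by exists phi.
Qed.

(** Subgroups are [Prop] predicates here, so that existential statements can serve as induction
    predicates; [generated_ind] passes back to the boolean ones. *)
Definition is_subgroup (G : groupType) (P : G -> Prop) :=
  [/\ P 1, forall x y, P x -> P y -> P (x * y) & forall x, P x -> P x^-1].

Section Subgroups.
Variable G : groupType.
Implicit Types (P Q : G -> Prop) (x y z : G).

Definition is_normal P := is_subgroup P /\ forall x y, P x -> P (x ^ y).

Lemma subgroup_gpred (H : groupClosed G) : is_subgroup (fun x => x \in H).
Proof.
by split=> [|x y|x]; [exact: gpred1 | exact: gpredM | rewrite gpredV].
Qed.

Lemma generated_ind (A P : G -> Prop) : is_subgroup P ->
  (forall x, A x -> P x) -> forall x, x \in generated A -> P x.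
Proof.
move=> [P1 PM PV] AP x /generatedP xA.
pose Q : {pred G} := fun z => `[< P z >].
have Q1 : 1 \in Q by apply/asboolP.
have QM : mulg_closed Q.
  by move=> y z /asboolP Py /asboolP Pz; apply/asboolP/PM.
have QV : invg_closed Q by move=> y /asboolP Py; apply/asboolP/PV.
pose m1 := isMulClosed.Build G Q QM.
pose m2 := isMul1Closed.Build G Q Q1.
pose m3 := isInvClosed.Build G Q QV.
pose H : groupClosed G := HB.pack Q m1 m2 m3.
by apply/asboolP/(xA H) => y Ay; apply/asboolP/AP.
Qed.

Lemma derived_ind n P : is_subgroup P ->
  (forall x y, x \in derived_series G n -> y \in derived_series G n ->
    P [~ x, y]) ->
  forall x, x \in derived_series G n.+1 -> P x.
Proof.
by move=> sP PR; apply: generated_ind => // _ [x [y [xn yn ->]]]; apply: PR.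
Qed.

Lemma derivedR n x y : x \in derived_series G n -> y \in derived_series G n ->
  [~ x, y] \in derived_series G n.+1.
Proof. by move=> xn yn; apply: mem_generated; exists x, y. Qed.

Lemma derived_anti m n : (m <= n)%N ->
  {subset derived_series G n <= derived_series G m}.
Proof.
move=> /subnK <-; elim: (n - m)%N => // k IHk x xk.
exact/IHk/derived_series_sub.
Qed.

Lemma preim_subgroup (K : groupType) (f : ghom K G) P :
  is_subgroup P -> is_subgroup (fun y : K => P (f y)).
Proof.
move=> [P1 PM PV]; split=> [|y z Py Pz|y Py].
- by rewrite gmulf1.
- by rewrite gmulfM; apply: PM.
- by rewrite gmulfV; apply: PV.
Qed.

Definition generates (A : G -> Prop) :=
  forall P, is_subgroup P -> (forall x, A x -> P x) -> forall x, P x.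

(** Stability under [y^-1] is part of the condition: in an infinite group a conjugate of a subgroup
    may be a proper part of it, so stability under [y] alone need not pass to inverses. *)
Lemma normalizer_subgroup P : is_subgroup P ->
  is_subgroup (fun y => forall x, P x -> P (x ^ y) /\ P (x ^ y^-1)).
Proof.
move=> sP; split=> [x Px|x y Nx Ny z Pz|x Nx y Py].
- by rewrite invg1 conjg1.
- split; first by rewrite conjgM; have [/Ny[]] := Nx z Pz.
  by rewrite invgM conjgM; have [_ /Nx[]] := Ny z Pz.
- by rewrite invgK; have [] := Nx y Py.
Qed.

Lemma normal_of_generators A P : generates A -> is_subgroup P ->
  (forall x y, A y -> P x -> P (x ^ y) /\ P (x ^ y^-1)) -> is_normal P.
Proof.
move=> genA sP AP; split=> // x y Px.
suff /(_ x Px)[] : forall x, P x -> P (x ^ y) /\ P (x ^ y^-1) by [].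
by apply: (genA _ (normalizer_subgroup sP)) => z Az w; apply: AP.
Qed.

Lemma commMg x y z : [~ x * y, z] = [~ x, z] ^ y * [~ y, z].
Proof. by rewrite /commg /conjg !(mulgA, invgM, invgK, mulgK). Qed.

Lemma commVg x y : [~ x^-1, y] = ([~ x, y]^-1) ^ x^-1.
Proof. by rewrite /commg /conjg !(mulgA, invgM, invgK, mulgK, mulgV, mul1g). Qed.

Lemma comm_subgroup P z : is_normal P -> is_subgroup (fun x => P [~ x, z]).
Proof.
move=> [[P1 PM PV] PJ]; split=> [|x y Px Py|x Px].
- by rewrite comm1g.
- by rewrite commMg; apply: PM => //; apply: PJ.
- by rewrite commVg; apply/PJ/PV.
Qed.

(** Induction on one argument at a time, by [comm_subgroup]; exchanging the arguments only inverts
    the commutator. *)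
Lemma commutators_of_generators A P : generates A -> is_normal P ->
  (forall x y, A x -> A y -> P [~ x, y]) -> forall x y, P [~ x, y].
Proof.
move=> genA nP AP; have [[P1 PM PV] PJ] := nP.
have sw x y : P [~ x, y] -> P [~ y, x] by move=> /PV; rewrite invgR.
move=> x y; apply: (genA _ (comm_subgroup y nP)) => {}x Ax; apply: sw.
apply: (genA _ (comm_subgroup x nP)) => {}y Ay; exact: AP.
Qed.

Lemma derived1_of_generators A P : generates A -> is_normal P ->
  (forall x y, A x -> A y -> P [~ x, y]) ->
  forall x, x \in derived_series G 1 -> P x.
Proof.
move=> genA nP AP; apply: derived_ind => [|x y _ _]; first by case: nP.
exact: (commutators_of_generators genA nP).
Qed.

End Subgroups.

Lemma derived_hom (G K : groupType) (f : ghom G K) m n :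
  (forall x, f x \in derived_series K m) ->
  forall x, x \in derived_series G n -> f x \in derived_series K (m + n).
Proof.
move=> f0; elim: n => [|n IHn]; first by move=> x _; rewrite addn0.
apply: derived_ind; first exact: (preim_subgroup f (subgroup_gpred _)).
by move=> x y xn yn /=; rewrite gmulfR addnS; apply: derivedR; apply: IHn.
Qed.

Section QuotientHom.
Variables (G : groupType) (N : normalClosed G).

Lemma cosetM : {morph coset N : x y / x * y}.
Proof. by move=> x y; rewrite -quotient_mulE. Qed.

HB.instance Definition _ :=
  isUMagmaMorphism.Build G (quotient_group N) (coset N) (conj erefl cosetM).

Lemma coset_surj (y : quotient_group N) : exists x, coset N x = y.
Proof. by exists (repr y); apply: reprK_coset. Qed.

Lemma coset1P x : coset N x = 1 <-> x \in N.
Proof.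
rewrite (_ : 1 = coset N 1) //; split=> [e|xN].
  have /coset_eqP : coset N 1 = coset N x by [].
  by rewrite invg1 mul1g.
by apply/esym/coset_eqP; rewrite invg1 mul1g.
Qed.

Lemma quotient_lift (H : groupType) (phi : ghom G H) :
  (forall x, x \in N -> phi x = 1) ->
  exists f : ghom (quotient_group N) H, forall x, f (coset N x) = phi x.
Proof.
move=> kN; have E x : phi (repr (coset N x)) = phi x.
  have /coset_eqP/kN := reprK_coset (coset N x).
  by rewrite gmulfM gmulfV => /mulg1_eq; rewrite invgK.
have [|f fE] := @hom_of_morph _ H (fun y : quotient_group N => phi (repr y)).
  move=> x y; have [a <-] := coset_surj x; have [b <-] := coset_surj y.
  by rewrite -cosetM !E gmulfM.
by exists f => x; rewrite fE E.
Qed.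

Lemma first_isomorphism (H : groupType) (phi : ghom G H) :
  (forall x, phi x = 1 <-> x \in N) -> (forall y, exists x, phi x = y) ->
  exists f : {multiplicative quotient_group N -> H},
    bijective f /\ forall x, f (coset N x) = phi x.
Proof.
move=> kN surj; have [|f fE] := @quotient_lift H phi; first by move=> x /kN.
exists f; split=> //.
have finj : injective f.
  apply: gmulf_inj => y; have [x <-] := coset_surj y.
  by rewrite fE => /kN xN; apply/coset1P.
have fsurj y : exists x, f x = y.
  by have [x <-] := surj y; exists (coset N x); rewrite fE.
have [g gE] := choice fsurj.
by exists g => [x|//]; apply: finj; rewrite gE.
Qed.

Lemma generates_quotient (A : G -> Prop) : generates A ->
  generates (fun y => exists2 x, A x & y = coset N x).
Proof.
move=> genA P sP AP y; have [x <-] := coset_surj y.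
apply: (genA _ (preim_subgroup (coset N) sP)) => {}x Ax.
by apply: AP; exists x.
Qed.

End QuotientHom.

Lemma normal_closure_sub (G : groupType) (A P : G -> Prop) : is_normal P ->
  (forall x, A x -> P x) -> forall x, x \in normal_closure A -> P x.
Proof.
move=> [sP PJ] AP; apply: generated_ind => // _ [x [y [/AP Px ->]]].
exact: PJ.
Qed.

Lemma ker_normal (G H : groupType) (f : ghom G H) : is_normal (fun x => f x = 1).
Proof.
split; [split|] => [|x y fx fy|x fx|x y fx].
- exact: gmulf1.
- by rewrite gmulfM fx fy mulg1.
- by rewrite gmulfV fx invg1.
- by rewrite gmulfJ fx conj1g.
Qed.

Section Words.
Variables (I : choiceType) (G : groupType).
Implicit Types (f : I -> G) (w : word I).

Definition letter f (x : I * bool) := if x.2 then f x.1 else (f x.1)^-1.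

Definition eval f w : G := foldr (fun x y => letter f x * y) 1 w.

Lemma eval_cat f w1 w2 : eval f (w1 ++ w2) = eval f w1 * eval f w2.
Proof. by elim: w1 => [|x w IHw] /=; rewrite ?mul1g // IHw mulgA. Qed.

Lemma letterV f x : letter f (x.1, ~~ x.2) = (letter f x)^-1.
Proof. by case: x => i [] //=; rewrite /letter /= invgK. Qed.

Lemma eval_inv f w : eval f (word_inv w) = (eval f w)^-1.
Proof.
elim: w => [|x w IHw]; first by rewrite invg1.
rewrite -cat1s word_inv_cat eval_cat IHw /= mulg1 letterV.
by rewrite invgM.
Qed.

Lemma eval_rel f w1 w2 : word_rel w1 w2 -> eval f w1 = eval f w2.
Proof.
move=> /word_relP; elim=> // {w1 w2}[_ _ [u v i b]|u v w _ -> _ -> //].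
by rewrite !eval_cat /= (letterV f (i, b)) mulg1 mulgV mul1g.
Qed.

Lemma eval_ext f g w : f =1 g -> eval f w = eval g w.
Proof.
by move=> fg; elim: w => //= x w ->; congr (_ * _); rewrite /letter fg.
Qed.

Lemma free_lift f :
  exists phi : ghom (free_group I) G, forall w, phi (word_class w) = eval f w.
Proof.
have E w : eval f (repr (word_class w)) = eval f w.
  by apply/eval_rel/word_classP/repr_word_class.
have [|phi phiE] := @hom_of_morph _ G (fun a : free_group I => eval f (repr a)).
  by move=> a b; rewrite -eval_cat -[RHS]E.
by exists phi => w; rewrite phiE E.
Qed.

Lemma eval_subgroup f : is_subgroup (fun x => exists w, x = eval f w).
Proof.
split=> [|x y [w ->] [w' ->]|x [w ->]].
- by exists [::].
- by exists (w ++ w'); rewrite eval_cat.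
- by exists (word_inv w); rewrite eval_inv.
Qed.

Lemma eval_mem f w (P : G -> Prop) : is_subgroup P -> (forall i, P (f i)) ->
  P (eval f w).
Proof.
move=> [P1 PM PV] Pf; elim: w => //= -[i b] w Pw; apply: PM => //.
by case: b; [exact: Pf | exact/PV/Pf].
Qed.

End Words.

Lemma hom_eval (I : choiceType) (G H : groupType) (phi : ghom G H) (f : I -> G) w :
  phi (eval f w) = eval (phi \o f) w.
Proof.
elim: w => [|x w IHw] /=; first exact: gmulf1.
by rewrite gmulfM IHw; congr (_ * _); rewrite /letter /=; case: x.2; rewrite ?gmulfV.
Qed.

Lemma free_group_generates (I : choiceType) :
  generates (fun x : free_group I => exists i, x = free_gen i).
Proof.
move=> P sP AP x; have /= <- := repr_word_class x.
suff -> : word_class (repr x) = eval (@free_gen I) (repr x).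
  by apply: eval_mem => // i; apply: AP; exists i.
elim: (repr x) => [//|[i b] w IHw] /=; rewrite -IHw.
have -> : letter (@free_gen I) (i, b) = word_class [:: (i, b)].
  by case: b => //; rewrite /letter /=; exact: (free_invE [:: (i, true)]).
exact: esym (free_mulE [:: (i, b)] w).
Qed.

(** * Permutations and the presentation of B_4 *)

Section Bijections.
Variable T : Type.

Record bij := Bij {
  bij_fun :> T -> T;
  bij_inv : T -> T;
  bij_funK : cancel bij_fun bij_inv;
  bij_invK : cancel bij_inv bij_fun
}.

Lemma bijP (f g : bij) : f =1 g -> f = g.
Proof.
case: f g => [f f' fK f'K] [g g' gK g'K] /= /funext fg; subst g.
have e : f' = g' by apply/funext => x; rewrite -{1}(g'K x) fK.
by subst g'; congr Bij; apply: Prop_irrelevance.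
Qed.

HB.instance Definition _ := gen_eqMixin bij.
HB.instance Definition _ := gen_choiceMixin bij.

(* Permutations are multiplied from left to right, as they act on the right. *)
Definition bij_mul (f g : bij) : bij :=
  Bij (can_comp (bij_funK g) (bij_funK f)) (can_comp (bij_invK f) (bij_invK g)).
Definition bij_one : bij := @Bij id id (fun=> erefl) (fun=> erefl).
Definition bij_opp (f : bij) : bij := Bij (bij_invK f) (bij_funK f).

Fact bij_mulA : associative bij_mul. Proof. by move=> f g h; apply: bijP. Qed.
Fact bij_1mul : left_id bij_one bij_mul. Proof. by move=> f; apply: bijP. Qed.
Fact bij_mul1 : right_id bij_one bij_mul. Proof. by move=> f; apply: bijP. Qed.
Fact bij_Vmul : left_inverse bij_one bij_opp bij_mul.
Proof. by move=> f; apply: bijP => x /=; rewrite bij_invK. Qed.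
Fact bij_mulV : right_inverse bij_one bij_opp bij_mul.
Proof. by move=> f; apply: bijP => x /=; rewrite bij_funK. Qed.

HB.instance Definition _ :=
  isGroup.Build bij bij_mulA bij_1mul bij_mul1 bij_Vmul bij_mulV.

Lemma bijM (f g : bij) x : (f * g) x = g (f x). Proof. by []. Qed.
Lemma bijVK (f : bij) x : f^-1 (f x) = x. Proof. exact: bij_funK. Qed.
Lemma bijKV (f : bij) x : f (f^-1 x) = x. Proof. exact: bij_invK. Qed.

End Bijections.

Definition i0 : 'I_3 := @Ordinal 3 0 isT.
Definition i1 : 'I_3 := @Ordinal 3 1 isT.
Definition i2 : 'I_3 := @Ordinal 3 2 isT.

Definition braid_rels (G : groupType) (x1 x2 x3 : G) :=
  [/\ x1 * x3 = x3 * x1, x1 * x2 * x1 = x2 * x1 * x2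
    & x2 * x3 * x2 = x3 * x2 * x3].

Notation braid4 := (braid_group 4).

Definition sigma (i : 'I_3) : braid4 :=
  coset (normal_closure (@braid_relator 4)) (free_gen i).
Definition s1 : braid4 := sigma i0.
Definition s2 : braid4 := sigma i1.
Definition s3 : braid4 := sigma i2.

Lemma braid4_rels : braid_rels s1 s2 s3.
Proof.
have E (x y : free_group 'I_3) : @braid_relator 4 (x * y^-1) ->
    coset (normal_closure (@braid_relator 4)) x = coset (normal_closure (@braid_relator 4)) y.
  move=> r; apply: divg1_eq; rewrite -gmulfF; apply/coset1P/mem_generated.
  by exists (x / y), 1; rewrite conjg1.
split.
- by have := E _ _ (@braid_far 4 i0 i2 isT); rewrite !cosetM.
- by have := E _ _ (@braid_near 4 i0 i1 erefl); rewrite !cosetM.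
- by have := E _ _ (@braid_near 4 i1 i2 erefl); rewrite !cosetM.
Qed.

Lemma braid4_lift (G : groupType) (x1 x2 x3 : G) : braid_rels x1 x2 x3 ->
  exists phi : ghom braid4 G, [/\ phi s1 = x1, phi s2 = x2 & phi s3 = x3].
Proof.
move=> [e13 e12 e23].
pose f (i : 'I_3) := nth 1 [:: x1; x2; x3] i.
have [phi phiE] := free_lift f.
have phig i : phi (free_gen i) = f i by rewrite phiE /= mulg1.
have [|psi psiE] := @quotient_lift _ (normal_closure (@braid_relator 4)) _ phi.
  apply: normal_closure_sub; first exact: ker_normal.
  move=> _ [] [[|[|[|//]]] pi] [[|[|[|//]]] pj] //= _;
    rewrite gmulfF !gmulfM !phig /f /= ?e13 ?e12 ?e23 ?mulgV //.
by exists psi; rewrite /s1 /s2 /s3 /sigma !psiE !phig.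
Qed.

Lemma braid4_generates : generates (fun x => [\/ x = s1, x = s2 | x = s3]).
Proof.
move=> P sP AP; apply: (generates_quotient (@free_group_generates _) sP).
move=> _ [_ [[[|[|[|//]]] pi] ->] ->].
- by apply: AP; constructor 1; congr sigma; apply: val_inj.
- by apply: AP; constructor 2; congr sigma; apply: val_inj.
- by apply: AP; constructor 3; congr sigma; apply: val_inj.
Qed.

Definition elt_a (G : groupType) (x1 x3 : G) : G := x3 * x1^-1.
Definition elt_b (G : groupType) (x1 x2 x3 : G) : G := elt_a x1 x3 ^ x2^-1.
Definition elt_u (G : groupType) (x1 x2 : G) : G := x2 * x1^-1.
Definition elt_v (G : groupType) (x1 x2 : G) : G := elt_u x1 x2 ^ x1^-1.

(** * Conjugation of a, b, u, v by the Artin generators *)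

Section BraidIdentities.
Variables (G : groupType) (x1 x2 x3 : G).
Hypothesis rels : braid_rels x1 x2 x3.

Local Notation a := (elt_a x1 x3).
Local Notation b := (elt_b x1 x2 x3).
Local Notation u := (elt_u x1 x2).
Local Notation v := (elt_v x1 x2).

Lemma braid_conjV (y z : G) : y * z * y = z * y * z ->
  y^-1 * z^-1 * y = z * y^-1 * z^-1.
Proof.
move=> e; apply: (mulgI (z * y)); rewrite !mulgA mulgK mulgV mul1g.
by rewrite -e mulgK mulgK.
Qed.

Lemma braid_conj (y z : G) : y * z * y = z * y * z ->
  y^-1 * z = z * y * z^-1 * y^-1.
Proof. by move=> e; apply: (mulgI y); rewrite mulVKg !mulgA e !mulgK. Qed.

(** Two braid moves: [x3 * x2 * x3 = x2 * x3 * x2], then [x2 * x1^-1 * x2^-1 = x1^-1 * x2^-1 * x1].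
    As [x1^-1 * x3] is [a], this gives the conjugate of [b] by [x1]. *)
Lemma mul_s3b : x3 * b = b * x1.
Proof.
have [_ e12 e23] := rels; rewrite /elt_b /elt_a /conjg invgK !mulgA -e23.
by rewrite -!mulgA; congr (_ * (_ * _)); rewrite !mulgA -braid_conjV.
Qed.

Lemma conj_a1 : a ^ x1 = a.
Proof.
have [e13 _ _] := rels; rewrite /elt_a /conjg mulgVK; apply: (mulgI x1).
by rewrite mulVKg mulgA e13 mulgK.
Qed.

Lemma conj_b1 : b ^ x1 = a * b.
Proof. by rewrite -[in RHS]conj_a1 /conjg -mul_s3b !mulgA mulgVK. Qed.

Lemma conj_a1V : a ^ x1^-1 = a.
Proof. by rewrite -{1}conj_a1 conjgK. Qed.

Lemma conj_b1V : b ^ x1^-1 = a^-1 * b.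
Proof.
by apply: (conjg_inj x1); rewrite conjgKV (conjMg a^-1) (conjVg a) conj_a1 conj_b1 mulKg.
Qed.

Lemma conj_b2 : b ^ x2 = a. Proof. exact: conjgKV. Qed.

(** Expanding [x2^-1 * x3] and [x1^-1 * x2] by [braid_conj] gives [x3 * b^-1 * x1^-1]; then
    [mul_s3b] rewrites the middle [b^-1] as [x1^-1 * b^-1 * x3]. *)
Lemma conj_a2 : a ^ x2 = a * b^-1 * a.
Proof.
have [e13 e12 e23] := rels.
have h : b^-1 = x1^-1 * b^-1 * x3.
  have : forall y, x3 * y = y * x1 -> y^-1 = x1^-1 * y^-1 * x3.
    by move=> y e; rewrite -invgM -e invgM mulgVK.
  by apply; exact: mul_s3b.
transitivity (x3 * b^-1 * x1^-1); last by rewrite {1}h /elt_a !mulgA.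
rewrite /elt_b -conjVg /conjg invgK /elt_a.
have -> : (x3 * x1^-1)^-1 = x3^-1 * x1.
  by rewrite invgM invgK; apply: (mulgI x3); rewrite mulVKg mulgA -e13 mulgK.
have -> : x2^-1 * (x3 * x1^-1 * x2) = (x2^-1 * x3) * (x1^-1 * x2).
  by rewrite !mulgA.
by rewrite (braid_conj e23) (braid_conj e12) !mulgA mulgVK.
Qed.

Lemma conj_b2V : b ^ x2^-1 = b * a^-1 * b.
Proof.
apply: (conjg_inj x2); rewrite conjgKV (conjMg (b * _)) (conjMg b) (conjVg a).
rewrite conj_b2 conj_a2 (invgM (a * _)) (invgM a) invgK.
by rewrite mulVKg mulgVK.
Qed.

Lemma conj_v1 : v ^ x1 = u. Proof. exact: conjgKV. Qed.

Lemma conj_u1 : u ^ x1 = u * v^-1.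
Proof.
have [_ e12 _] := rels; rewrite /elt_v -conjVg /elt_u invgM invgK.
by rewrite /conjg invgK mulgVK (braid_conj e12) -!mulgA mulKg.
Qed.

Lemma s2_eq : x2 = u * x1. Proof. by rewrite /elt_u mulgVK. Qed.
Lemma s3_eq : x3 = a * x1. Proof. by rewrite /elt_a mulgVK. Qed.

End BraidIdentities.

(** * Rewriting words in N *)

Section IntegerPowers.
Variable G : groupType.
Implicit Types (x y : G) (m n : int).

Definition zexp x n := match n with Posz k => x ^+ k | Negz k => x ^- k.+1 end.

Lemma zexp_succ x n : zexp x (1 + n)%R = x * zexp x n.
Proof.
case: n => k; first exact: expgS.
rewrite NegzE; case: k => [|k]; first by rewrite /= expg1 mulgV.
have -> : (1 - k.+2%:Z = Negz k)%R by rewrite NegzE [in LHS]intS opprD addrA subrr add0r.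
by rewrite NegzE /= -!expVgn [x^-1 ^+ k.+2]expgS mulVKg.
Qed.

Lemma zexp_pred x n : zexp x (-1 + n)%R = x^-1 * zexp x n.
Proof. by apply: (mulgI x); rewrite mulVKg -zexp_succ addrA subrr add0r. Qed.

Lemma zexpD x m n : zexp x (m + n)%R = zexp x m * zexp x n.
Proof.
elim/int_rec: m => [|m IHm|m IHm]; first by rewrite add0r mul1g.
- by rewrite intS -addrA !zexp_succ IHm mulgA.
- by rewrite intS opprD -addrA !zexp_pred IHm mulgA.
Qed.

Lemma zexpN x n : zexp x (- n)%R = (zexp x n)^-1.
Proof. by apply/esym/mulg1_eq; rewrite -zexpD subrr. Qed.

Lemma zexp1g n : zexp 1 n = 1 :> G.
Proof. by case: n => k; rewrite /= expg1n ?invg1. Qed.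

Lemma zexp1 x : zexp x 1%R = x. Proof. by []. Qed.
Lemma zexpN1 x : zexp x (- 1)%R = x^-1. Proof. by []. Qed.

Lemma commute_zexp x y n : commute x y -> commute x (zexp y n).
Proof. by move=> xy; case: n => k; rewrite /zexp; [|apply: commuteV]; apply: commuteX. Qed.

Lemma commute_zexp2 x y m n : commute x y -> commute (zexp x m) (zexp y n).
Proof. by move=> xy; apply/commute_zexp/commute_sym/commute_zexp/commute_sym. Qed.

Lemma zexpM x m n : zexp x (m * n)%R = zexp (zexp x m) n.
Proof.
elim/int_rec: n => [|n IHn|n IHn]; first by rewrite mulr0.
- by rewrite intS mulrDr mulr1 zexpD zexp_succ IHn.
- by rewrite intS opprD mulrDr mulrN1 zexpD zexpN zexp_pred IHn.
Qed.

End IntegerPowers.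

Section Substitution.
Variable I : choiceType.
Implicit Types (w : word I) (s : I -> word I).

(** Cancelling at the head keeps a reduced word reduced, so the words stay short under the long
    iterated substitutions that are evaluated later. *)
Definition cancel_cons (x : I * bool) w : word I :=
  if w is y :: w' then if y == (x.1, ~~ x.2) then w' else x :: w else [:: x].

Definition subst s w : word I :=
  foldr (fun x w' => foldr cancel_cons w'
           (if x.2 then s x.1 else word_inv (s x.1))) [::] w.

Variable G : groupType.

Lemma eval_cancel_cons (f : I -> G) x w :
  eval f (cancel_cons x w) = letter f x * eval f w.
Proof.
case: w => [|y w] //=; case: eqP => [->|//].
by rewrite letterV mulVKg.
Qed.

Lemma eval_subst (f : I -> G) s w :
  eval f (subst s w) = eval (fun i => eval f (s i)) w.
Proof.
have E v w' : eval f (foldr cancel_cons w' v) = eval f v * eval f w'.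
  by elim: v => [|x v IHv] /=; rewrite ?mul1g // eval_cancel_cons IHv mulgA.
elim: w => [|[i c] w IHw] //=; rewrite E IHw; congr (_ * _).
by case: c => //=; rewrite eval_inv.
Qed.

Lemma eval_conj (f : I -> G) w y : eval f w ^ y = eval (fun i => f i ^ y) w.
Proof. exact: (hom_eval (conj_by y)). Qed.

End Substitution.

Notation la := (true, true).
Notation lA := (true, false).
Notation lb := (false, true).
Notation lB := (false, false).

(* In a braid word, the letters [la] and [lb] stand for [s1] and [s2]; in a word
   over the generators of N, they stand for [a] and [b]. *)
Definition braid_subst (x : bool * bool) (c : bool) : word bool :=
  match x, c with
  | la, true => [:: la]      | la, false => [:: la; lb]
  | lA, true => [:: la]      | lA, false => [:: lA; lb]
  | lb, true => [:: la; lB; la] | lb, false => [:: la]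
  | lB, true => [:: lb]      | lB, false => [:: lb; lA; lb]
  end.

Definition braid_act (v w : word bool) : word bool :=
  foldl (fun w' x => subst (braid_subst x) w') w v.

Definition wu : word bool := [:: lb; lA].
Definition wv : word bool := [:: la; lb; lA; lA].

Definition pick_gen (G : groupType) (x y : G) (c : bool) := if c then x else y.

Section BraidAction.
Variables (G : groupType) (x1 x2 x3 : G).
Hypothesis rels : braid_rels x1 x2 x3.

Local Notation a := (elt_a x1 x3).
Local Notation b := (elt_b x1 x2 x3).
Local Notation u := (elt_u x1 x2).
Local Notation v := (elt_v x1 x2).

Lemma eval_braid_subst x w :
  eval (pick_gen a b) w ^ letter (pick_gen x1 x2) x =
  eval (pick_gen a b) (subst (braid_subst x) w).
Proof.
rewrite eval_conj eval_subst; apply: eval_ext => c.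
case: x c => [[] []] [] /=; rewrite /letter /pick_gen /= ?mulg1.
- exact: conj_a1 rels.
- exact: conj_b1 rels.
- exact: conj_a1V rels.
- exact: conj_b1V rels.
- by rewrite (conj_a2 rels) -mulgA.
- exact: conj_b2.
- by [].
- by rewrite (conj_b2V rels) -mulgA.
Qed.

Lemma eval_braid_act t w :
  eval (pick_gen a b) w ^ eval (pick_gen x1 x2) t =
  eval (pick_gen a b) (braid_act t w).
Proof.
elim: t w => [|x t IHt] w /=; first by rewrite conjg1.
by rewrite conjgM eval_braid_subst IHt.
Qed.

Lemma eval_wu : eval (pick_gen x1 x2) wu = u.
Proof. by rewrite /= /letter /pick_gen /= mulg1. Qed.

Lemma eval_wv : eval (pick_gen x1 x2) wv = v.
Proof.
by rewrite /= /letter /pick_gen /= mulg1 /elt_v /conjg invgK /elt_u !mulgA.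
Qed.

End BraidAction.

(** * Reidemeister-Schreier rewriting and normal forms in N / K' *)

Definition Z5 : zmodType := (int * int * int * int * int)%type.
Definition mkZ5 (h1 h2 h3 y1 y2 : int) : Z5 := (h1, h2, h3, y1, y2).

(* Reidemeister-Schreier rewriting for K in N: the state [(i, j)] stands for the
   coset of the representative [a ^ i * b ^ j], and the coordinates on K / K'
   are relative to [wh1], [wh2], [wh3], [wy1], [wy2] below. *)
Definition delta (t x : bool * bool) : Z5 * (bool * bool) :=
  match t, x with
  | (false, false), la => (0, (true, false))
  | (true, false), la => (mkZ5 1 0 0 0 0, (false, false))
  | (false, true), la => (mkZ5 0 0 1 0 0, (true, true))
  | (true, true), la => (mkZ5 (-1) 0 (-1) 1 0, (false, true))
  | (true, false), lA => (0, (false, false))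
  | (false, false), lA => (mkZ5 (-1) 0 0 0 0, (true, false))
  | (true, true), lA => (mkZ5 0 0 (-1) 0 0, (false, true))
  | (false, true), lA => (mkZ5 1 0 1 (-1) 0, (true, true))
  | (false, false), lb => (0, (false, true))
  | (true, false), lb => (0, (true, true))
  | (false, true), lb => (mkZ5 0 1 0 0 0, (false, false))
  | (true, true), lb => (mkZ5 0 (-1) 0 0 1, (true, false))
  | (false, true), lB => (0, (false, false))
  | (true, true), lB => (0, (true, false))
  | (false, false), lB => (mkZ5 0 (-1) 0 0 0, (false, true))
  | (true, false), lB => (mkZ5 0 1 0 0 (-1), (true, true))
  end%R.

Fixpoint run (w : word bool) (t : bool * bool) : Z5 * (bool * bool) :=
  if w is x :: w' then
    let: (d, t1) := delta t x in let: (n, t2) := run w' t1 in ((d + n)%R, t2)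
  else (0%R, t).

Lemma run_cons x w t : run (x :: w) t =
  (((delta t x).1 + (run w (delta t x).2).1)%R, (run w (delta t x).2).2).
Proof. by rewrite /=; case: (delta t x) => d t1; case: (run w t1). Qed.

Notation st0 := (false, false).

(* [wy1] and [wy2] are the transfers of [a] and [b]. *)
Definition wh1 : word bool := [:: la; la].
Definition wh2 : word bool := [:: lb; lb].
Definition wh3 : word bool := [:: lb; la; lB; lA].
Definition wy1 : word bool := [:: la; la; lb; la; la; lB].
Definition wy2 : word bool := [:: lb; lb; la; lb; lb; lA].

Section LatticePowers.
Variables (G : groupType) (e1 e2 e3 e4 e5 : G).

Local Notation basis := [:: e1; e2; e3; e4; e5].

Definition zpow5 (n : Z5) : G :=
  let: (n1, n2, n3, n4, n5) := n in
  zexp e1 n1 * zexp e2 n2 * zexp e3 n3 * zexp e4 n4 * zexp e5 n5.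

Lemma zpow5_twist : zpow5 (mkZ5 (-1) 0 (-1) 1 0) = e1^-1 * e3^-1 * e4.
Proof. by rewrite /zpow5 /= !mulg1. Qed.

Lemma zpow5_y m n : zpow5 (mkZ5 0 0 0 m n) = zexp e4 m * zexp e5 n.
Proof. by rewrite /zpow5 /= !mul1g. Qed.

Hypothesis basisC : {in basis &, forall x y, commute x y}.

Lemma zpow5D m n : zpow5 (m + n)%R = zpow5 m * zpow5 n.
Proof.
case: m n => [[[[m1 m2] m3] m4] m5] [[[[n1 n2] n3] n4] n5].
rewrite /zpow5 /= !zexpD.
have ACA (x y z t : G) : commute z y -> x * z * (y * t) = x * y * (z * t).
  by move=> zy; rewrite -!mulgA; congr (_ * _); rewrite !mulgA zy.
have C x y k l : x \in basis -> y \in basis -> commute (zexp x k) (zexp y l).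
  by move=> xe ye; apply/commute_zexp2/basisC.
have [i1 i2 i3 [i4 i5]] : [/\ e1 \in basis, e2 \in basis, e3 \in basis
    & e4 \in basis /\ e5 \in basis] by rewrite !inE !eqxx !orbT.
rewrite [RHS]ACA; last by repeat apply: commuteM; apply: C.
congr (_ * (zexp e5 _ * zexp e5 _)).
rewrite [RHS]ACA; last by repeat apply: commuteM; apply: C.
congr (_ * (zexp e4 _ * zexp e4 _)).
rewrite [RHS]ACA; last by repeat apply: commuteM; apply: C.
by congr (_ * (zexp e3 _ * zexp e3 _)); apply/esym/ACA; apply: C.
Qed.

Lemma zpow50 : zpow5 0%R = 1.
Proof. by apply: (mulgI (zpow5 0%R)); rewrite -zpow5D addr0 mulg1. Qed.

Lemma zpow5N n : zpow5 (- n)%R = (zpow5 n)^-1.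
Proof. by apply/esym/mulg1_eq; rewrite -zpow5D subrr zpow50. Qed.

End LatticePowers.

Section Transversal.
Variables (G : groupType) (a b : G).

Local Notation ev := (eval (pick_gen a b)).
Local Notation basis := [:: ev wh1; ev wh2; ev wh3; ev wy1; ev wy2].

Definition xpow : Z5 -> G :=
  zpow5 (ev wh1) (ev wh2) (ev wh3) (ev wy1) (ev wy2).

Definition rep (t : bool * bool) : G :=
  (if t.1 then a else 1) * (if t.2 then b else 1).

Hypothesis basisC : {in basis &, forall x y, commute x y}.

Lemma rep_pos t (c : bool) :
  rep t * pick_gen a b c = xpow (delta t (c, true)).1 * rep (delta t (c, true)).2.
Proof.
have C13 : (ev wh1)^-1 * (ev wh3)^-1 = (ev wh3)^-1 * (ev wh1)^-1.
  by rewrite -!invgM basisC // !inE eqxx ?orbT.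
case: t c => [[] []] [].
(* Only [a * b * a] needs two basis elements to be exchanged; the other transitions are identities
   of free groups. *)
- rewrite [xpow _]zpow5_twist C13.
  by rewrite /rep /pick_gen /= /letter /= !gnorm.
all: by rewrite /rep /pick_gen /xpow /zpow5 /= /letter /= !gnorm.
Qed.

Lemma rep_letter t x :
  rep t * letter (pick_gen a b) x = xpow (delta t x).1 * rep (delta t x).2.
Proof.
case: x => c []; first exact: rep_pos.
rewrite /letter /=; apply: (mulIg (pick_gen a b c)); rewrite mulgVK -mulgA rep_pos.
have -> : (delta (delta t (c, false)).2 (c, true)).2 = t by case: c t => [] [[] []].
have -> : (delta (delta t (c, false)).2 (c, true)).1 = (- (delta t (c, false)).1)%R.
  by case: c t => [] [[] []].
by rewrite mulgA -zpow5D // subrr zpow50 // mul1g.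
Qed.

(** The word is collected from left to right. Only commutation of the five Schreier words is
    assumed, so this can be applied in B_4 / B_4''''. *)
Lemma rep_eval w t :
  rep t * ev w = xpow (run w t).1 * rep (run w t).2.
Proof.
elim: w t => [|x w IHw] t; first by rewrite [ev _]/= mulg1 [xpow _]zpow50 // mul1g.
rewrite [ev _]/= mulgA rep_letter run_cons -mulgA IHw mulgA.
by congr (_ * _); apply/esym/zpow5D.
Qed.

Lemma eval_run w : ev w = xpow (run w st0).1 * rep (run w st0).2.
Proof. by rewrite -rep_eval /rep /= !mul1g. Qed.

End Transversal.

(** * The model of N / K' modulo 18 *)

Section Model.
Variable R : comNzRingType.

(* With [R] the integers modulo 18, [modA] is Z^5 modulo 18 times the transfer
   lattice, and a point [(n, t)] stands for [x ^ n * rep t] in N / K'. *)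
Definition modA : zmodType := (int * int * int * R * R)%type.
Definition point : Type := (modA * (bool * bool))%type.

Definition castA (n : Z5) : modA :=
  let: (h1, h2, h3, y1, y2) := n in (h1, h2, h3, y1%:~R, y2%:~R)%R.

Definition rmul_fun (x : bool * bool) (p : point) : point :=
  ((p.1 + castA (delta p.2 x).1)%R, (delta p.2 x).2).

(* [tau1_fun] and [tau2_fun] are conjugation by [s1] and [s2]: the formulas come
   from rewriting the images of the basis and of the representatives under
   [braid_subst]. *)
Definition tau1_fun (p : point) : point :=
  let: (h1, h2, h3, y1, y2, t) := p in
  let: (c, t')  := match t with
    | (true, true) => (1, (false, true))
    | (false, true) => (0, (true, true))
    | (i, j) => (0, (i, j)) end%R in
  (h1 - h2 - 2 * h3 + c, h2, - h2 - h3, (h2 + h3)%:~R + y1 + y2, y2, t')%R.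

Definition tau1V_fun (p : point) : point :=
  let: (h1, h2, h3, y1, y2, t) := p in
  let: (c, t')  := match t with
    | (true, true) => (0, (false, true))
    | (false, true) => (-1, (true, true))
    | (i, j) => (0, (i, j)) end%R in
  (h1 - h2 - 2 * h3 + c, h2, - h2 - h3, h3%:~R + y1 - y2, y2, t')%R.

Definition tau2_fun (p : point) : point :=
  let: (h1, h2, h3, y1, y2, t) := p in
  let: (n, t') := match t with
    | (true, false) => (mkZ5 (-1) 1 (-1) 1 (-1), (false, true))
    | (false, true) => (0, (true, false))
    | (true, true) => (mkZ5 (-1) 1 0 1 (-1), (true, true))
    | (false, false) => (0, (false, false)) end%R in
  (((h2 + 2 * h3, h1 - 2 * h3, h3, (h1 - h3)%:~R + 2 * y1 + y2,
     (h3 - h1)%:~R - y1) : modA) + castA n, t')%R.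

Definition tau2V_fun (p : point) : point :=
  let: (h1, h2, h3, y1, y2, t) := p in
  let: (n, t') := match t with
    | (true, false) => (0, (false, true))
    | (false, true) => (mkZ5 1 (-1) 1 (-1) 1, (true, false))
    | (true, true) => (mkZ5 (-1) 1 0 0 0, (true, true))
    | (false, false) => (0, (false, false)) end%R in
  (((h2 + 2 * h3, h1 - 2 * h3, h3, - (h2 + h3)%:~R - y2,
     (h2 + h3)%:~R + y1 + 2 * y2) : modA) + castA n, t')%R.

Ltac by_points :=
  move=> [[[[[h1 h2] h3] y1] y2] [[] []]];
  rewrite /= /rmul_fun /=; do ?congr (_, _); rewrite /= ?mulr0z ?addr0; ring.

Fact tau1_funK : cancel tau1_fun tau1V_fun.
Proof. by_points. Qed.
Fact tau1V_funK : cancel tau1V_fun tau1_fun.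
Proof. by_points. Qed.
Fact tau2_funK : cancel tau2_fun tau2V_fun.
Proof. by_points. Qed.
Fact tau2V_funK : cancel tau2V_fun tau2_fun.
Proof. by_points. Qed.
Fact rmul_funK x : cancel (rmul_fun x) (rmul_fun (x.1, ~~ x.2)).
Proof. case: x => [] [] []; by_points. Qed.

Definition tau1 : bij point := Bij tau1_funK tau1V_funK.
Definition tau2 : bij point := Bij tau2_funK tau2V_funK.
Fact rmulV_funK x : cancel (rmul_fun (x.1, ~~ x.2)) (rmul_fun x).
Proof.
by move=> p; have := rmul_funK (x.1, ~~ x.2) p; rewrite /= negbK -surjective_pairing.
Qed.
Definition rmul x : bij point := Bij (rmul_funK x) (rmulV_funK x).

(** [s1] and [s2] act by conjugation and N by right multiplication, so [s3 = a * s1] must act as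
    right multiplication by [a] followed by [tau1]. *)
Lemma tau_rels : braid_rels tau1 tau2 (rmul la * tau1).
Proof. by split; apply: bijP; by_points. Qed.

Lemma elt_b_tau : rmul la ^ tau2^-1 = rmul lb.
Proof. apply: bijP; by_points. Qed.

Lemma model_hom : exists phi : ghom braid4 (bij point),
  [/\ phi s1 = tau1, phi s2 = tau2,
      phi (elt_a s1 s3) = rmul la & phi (elt_b s1 s2 s3) = rmul lb].
Proof.
have [phi [e1 e2 e3]] := braid4_lift tau_rels; exists phi.
have ea : phi (elt_a s1 s3) = rmul la.
  by rewrite /elt_a gmulfM gmulfV e1 e3 mulgK.
by split; rewrite // /elt_b gmulfJ gmulfV ea e2 elt_b_tau.
Qed.

Lemma castAD m n : castA (m + n)%R = (castA m + castA n)%R.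
Proof.
by case: m n => [[[[? ?] ?] ?] ?] [[[[? ?] ?] ?] ?]; do ?congr (_, _); rewrite ?rmorphD.
Qed.

Lemma castA0 : castA 0 = 0%R.
Proof. by apply: (addrI (castA 0)); rewrite -castAD !addr0. Qed.

Lemma eval_rmul w p :
  eval (pick_gen (rmul la) (rmul lb)) w p =
  ((p.1 + castA (run w p.2).1)%R, (run w p.2).2).
Proof.
elim: w p => [|x w IHw] [n t].
  by rewrite -[RHS]/((n + castA 0)%R, t) castA0 addr0.
rewrite [eval _ _]/= bijM.
have -> : letter (pick_gen (rmul la) (rmul lb)) x (n, t) =
    ((n + castA (delta t x).1)%R, (delta t x).2) by case: x => [[] []].
by rewrite IHw run_cons castAD addrA.
Qed.

(* The map [x |-> x + t (W (p x))] with [W = 3 Q - e]; here [p] is [(p1, p2)]. *)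
Definition fibre_map (e : bool) (q11 q12 q21 q22 : R) (n : modA) : modA :=
  let: (h1, h2, h3, y1, y2) := n in
  let p1 := (2 * y1 + h1%:~R)%R in
  let p2 := (2 * y2 + h2%:~R)%R in
  (h1, h2, h3, y1 + 3 * (q11 * p1 + q12 * p2) - p1 *+ e,
   y2 + 3 * (q21 * p1 + q22 * p2) - p2 *+ e)%R.

(** Only the fibre over [st0], which stands for K / K', is constrained. *)
Definition twists_fibre (g : bij point) : Prop :=
  exists e q11 q12 q21 q22,
    forall n, g (n, st0) = (fibre_map e q11 q12 q21 q22 n, st0).

Hypothesis char18 : (18%:R = 0 :> R)%R.

(** Turns an equality modulo 18 into a polynomial identity for [ring], with the quotient [z]
    supplied. *)
Lemma eq_mod18 (x y z : R) : (x - y = 18%:R * z -> x = y)%R.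
Proof. by rewrite char18 mul0r => /eqP; rewrite subr_eq0 => /eqP. Qed.

(** Since [p t = 2], composing the maps of [W] and [W'] gives the map of [W + W' + 2 W' W]. For
    [W = 3 Q - e] and [W' = 3 R - e'], the only term quadratic in the matrices is [18 R Q], which
    vanishes; the quotient passed to [eq_mod18] is [R Q p]. *)
Lemma fibre_mapM (e e' : bool) q11 q12 q21 q22 r11 r12 r21 r22 n :
  fibre_map e' r11 r12 r21 r22 (fibre_map e q11 q12 q21 q22 n) =
  fibre_map (addb e e') (q11 + r11 - 2 * e'%:R * q11 - 2 * e%:R * r11)%R
    (q12 + r12 - 2 * e'%:R * q12 - 2 * e%:R * r12)%R
    (q21 + r21 - 2 * e'%:R * q21 - 2 * e%:R * r21)%R
    (q22 + r22 - 2 * e'%:R * q22 - 2 * e%:R * r22)%R n.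
Proof.
case: n => [[[[h1 h2] h3] y1] y2].
pose p1 := (2 * y1 + h1%:~R)%R; pose p2 := (2 * y2 + h2%:~R)%R.
pose m1 := (q11 * p1 + q12 * p2)%R; pose m2 := (q21 * p1 + q22 * p2)%R.
rewrite /fibre_map; congr (_, _); [congr (_, _)|].
- apply: (@eq_mod18 _ _ (r11 * m1 + r12 * m2)%R).
  by case: e e' => [] []; rewrite /= ?mulr1n ?mulr0n /m1 /m2 /p1 /p2; ring.
- apply: (@eq_mod18 _ _ (r21 * m1 + r22 * m2)%R).
  by case: e e' => [] []; rewrite /= ?mulr1n ?mulr0n /m1 /m2 /p1 /p2; ring.
Qed.

Lemma fibre_map0 n : fibre_map false 0%R 0%R 0%R 0%R n = n.
Proof.
case: n => [[[[h1 h2] h3] y1] y2] /=.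
by rewrite !mul0r !addr0 !mulr0 !mulr0n !subr0 !addr0.
Qed.

Lemma twists_fibre_subgroup : is_subgroup twists_fibre.
Proof.
split.
- by exists false, 0%R, 0%R, 0%R, 0%R => n; rewrite fibre_map0.
- move=> g h [e [q11 [q12 [q21 [q22 gE]]]]] [e' [r11 [r12 [r21 [r22 hE]]]]].
  do 5!eexists; move=> n; rewrite bijM gE hE fibre_mapM; reflexivity.
- move=> g [e [q11 [q12 [q21 [q22 gE]]]]].
  exists e, (- q11)%R, (- q12)%R, (- q21)%R, (- q22)%R => n.
  apply: (can_inj (bij_funK g)); rewrite bijKV gE fibre_mapM addbb -[LHS]/(n, st0).
  congr (_, _); rewrite -[LHS]fibre_map0; congr (fibre_map _ _ _ _ _ _).
  all: by case: e {gE}; ring.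
Qed.

(** The composite in [fibre_mapM] is symmetric in the two maps, its quadratic term having vanished
    modulo 18. *)
Lemma unipotentC g h n : twists_fibre g -> twists_fibre h ->
  g (h (n, st0)) = h (g (n, st0)).
Proof.
move=> [e [q11 [q12 [q21 [q22 gE]]]]] [e' [r11 [r12 [r21 [r22 hE]]]]].
rewrite hE !gE hE !fibre_mapM addbC; congr (fibre_map _ _ _ _ _ _, _).
all: by case: e {gE} => []; case: e' {hE} => []; ring.
Qed.

Lemma twists_fibre_commg g h n : twists_fibre g -> twists_fibre h ->
  [~ g, h] (n, st0) = (n, st0).
Proof.
move=> ug uh; have [_ uM uV] := twists_fibre_subgroup.
have [e [q11 [q12 [q21 [q22 E]]]]] := uV _ (uM _ _ uh ug).
(* The inverse of [h * g] maps the fibre to itself, and [g * h] agrees with [h * g] there. *)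
have -> : [~ g, h] = (h * g)^-1 * (g * h) by rewrite /commg /conjg invgM !mulgA.
rewrite bijM E bijM (unipotentC _ uh ug) -E.
by rewrite -[RHS](bijKV (h * g)).
Qed.

Ltac conj_fibre e gE V1 V2 n :=
  rewrite -[LHS]/(V1 (_ (V2 (n, st0)))) [V2 _]/= gE /=;
  do ?congr (_, _); case: e {gE}; rewrite /= ?mulr0z ?mulr1n ?mulr0n; ring.

Lemma twists_fibre_conj_tau1 g : twists_fibre g ->
  twists_fibre (g ^ tau1) /\ twists_fibre (g ^ tau1^-1).
Proof.
move=> [e [q11 [q12 [q21 [q22 gE]]]]]; split.
(* The entries of [M Q M^-1], where [M] has rows (1, 1) and (0, 1): it is the matrix of [tau1] on N
   / N'. The scalar part [e] is unchanged. *)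
- exists e, (q11 + q21)%R, (q12 + q22 - q11 - q21)%R, q21, (q22 - q21)%R.
  move=> [[[[h1 h2] h3] y1] y2].
  conj_fibre e gE tau1_fun tau1V_fun (h1, h2, h3, y1, y2).
- exists e, (q11 - q21)%R, (q11 - q21 + q12 - q22)%R, q21, (q21 + q22)%R.
  move=> [[[[h1 h2] h3] y1] y2].
  conj_fibre e gE tau1V_fun tau1_fun (h1, h2, h3, y1, y2).
Qed.

Lemma twists_fibre_conj_tau2 g : twists_fibre g ->
  twists_fibre (g ^ tau2) /\ twists_fibre (g ^ tau2^-1).
Proof.
move=> [e [q11 [q12 [q21 [q22 gE]]]]]; split.
(* Likewise with the matrix of [tau2], whose rows are (2, 1) and (-1, 0). *)
- exists e, (2 * q12 + q22)%R, (2 * (2 * q12 + q22) - (2 * q11 + q21))%R,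
    (- q12)%R, (q11 - 2 * q12)%R.
  move=> [[[[h1 h2] h3] y1] y2].
  conj_fibre e gE tau2_fun tau2V_fun (h1, h2, h3, y1, y2).
- exists e, (q22 - 2 * q21)%R, (- q21)%R,
    (2 * (q11 + 2 * q21) - (q12 + 2 * q22))%R, (q11 + 2 * q21)%R.
  move=> [[[[h1 h2] h3] y1] y2].
  conj_fibre e gE tau2V_fun tau2_fun (h1, h2, h3, y1, y2).
Qed.

Lemma twists_fibre_comm_uv : twists_fibre [~ elt_u tau1 tau2, elt_v tau1 tau2].
Proof.
(* Here [W = 3 Q - 1] has rows (-10, -27) and (3, 8), and [1 + 2 W] is the matrix by which [u, v]
   acts on the transfer lattice. *)
exists true, (-3)%R, (-9)%R, 1%R, 3%R.
pose u := elt_u tau1 tau2; pose v := elt_v tau1 tau2.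
have uE p : u p = tau1V_fun (tau2_fun p) by [].
have uVE p : u^-1 p = tau2V_fun (tau1_fun p) by [].
have vE p : v p = tau1V_fun (u (tau1_fun p)) by [].
have vVE p : v^-1 p = tau1V_fun (u^-1 (tau1_fun p)) by [].
have -> : [~ elt_u tau1 tau2, elt_v tau1 tau2] = u^-1 * v^-1 * u * v.
  by rewrite /commg /conjg !mulgA.
(* The four factors are first put in closed form on the fibre, so that the final [ring] composes
   only linear formulas. *)
have {}uE h1 h2 h3 y1 y2 : u ((h1, h2, h3, y1, y2), st0) =
    ((- h1 + h2 + 2 * h3, h1 - 2 * h3, - h1 + h3,
      2 * h1%:~R - h3%:~R + 3 * y1 + y2, - h1%:~R + h3%:~R - y1)%R, st0).
  by rewrite uE /=; do ?congr (_, _); rewrite /= ?mulr0z; ring.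
have {}uVE h1 h2 h3 y1 y2 : u^-1 ((h1, h2, h3, y1, y2), st0) =
    ((- h2 - 2 * h3, h1 + h2, - h2 - h3,
      h3%:~R - y2, h2%:~R + y1 + 3 * y2)%R, st0).
  by rewrite uVE /=; do ?congr (_, _); rewrite /= ?mulr0z; ring.
have {}vE h1 h2 h3 y1 y2 : v ((h1, h2, h3, y1, y2), st0) =
    ((- h2 - 2 * h3, h1 + h2, - h2 - h3,
      2 * h1%:~R + 3 * h2%:~R + h3%:~R + 4 * y1 + 5 * y2,
      - h1%:~R - h2%:~R - y1 - y2)%R, st0).
  by rewrite vE uE /=; do ?congr (_, _); rewrite /= ?mulr0z; ring.
have {}vVE h1 h2 h3 y1 y2 : v^-1 ((h1, h2, h3, y1, y2), st0) =
    ((- h1 + h2 + 2 * h3, h1 - 2 * h3, - h1 + h3,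
      - 3 * h2%:~R - h3%:~R - y1 - 5 * y2,
      2 * h2%:~R + h3%:~R + y1 + 4 * y2)%R, st0).
  by rewrite vVE uVE /=; do ?congr (_, _); rewrite /= ?mulr0z; ring.
move=> [[[[h1 h2] h3] y1] y2]; rewrite (bijM (u^-1 * v^-1 * u) v).
rewrite (bijM (u^-1 * v^-1) u) (bijM u^-1) uVE vVE uE vE.
by do ?congr (_, _); rewrite /= ?mulr0z ?mulr1n; ring.
Qed.

(** * The action on N / K *)

Definition shifts_state (d : bool * bool) (g : bij point) :=
  forall p, (g p).2 = (addb p.2.1 d.1, addb p.2.2 d.2).

Definition preserves_states (g : bij point) := forall p, (g p).2 = p.2.

Definition state_compatible (g : bij point) :=
  forall p q, p.2 = q.2 -> (g p).2 = (g q).2 /\ (g^-1 p).2 = (g^-1 q).2.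

Lemma state_compatible_subgroup : is_subgroup state_compatible.
Proof.
split=> [p q|g h cg ch p q e|g cg p q e] //; last by rewrite invgK; case: (cg p q e).
split; first by have [+ _] := cg p q e => /ch[].
by have [_ +] := ch p q e => /cg[_]; rewrite invgM.
Qed.

Lemma state_compatible_tau1 : state_compatible tau1.
Proof. by case=> [[[[[? ?] ?] ?] ?] [[] []]] [[[[[? ?] ?] ?] ?] [[] []]]. Qed.
Lemma state_compatible_tau2 : state_compatible tau2.
Proof. by case=> [[[[[? ?] ?] ?] ?] [[] []]] [[[[[? ?] ?] ?] ?] [[] []]]. Qed.
Lemma state_compatible_rmul x : state_compatible (rmul x).
Proof. by move=> [n t] [m t'] /= ->. Qed.

Lemma preserves_states_subgroup : is_subgroup preserves_states.
Proof.
split=> [p|g h cg ch p|g cg p] //; first by rewrite bijM ch.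
by rewrite -{2}[p](bijKV g) cg.
Qed.

Lemma preserves_states_conj g h : preserves_states g -> state_compatible h ->
  preserves_states (g ^ h).
Proof.
move=> pg ch p; rewrite -[LHS]/((h (g (h^-1 p))).2).
have [-> _] := ch (g (h^-1 p)) (h^-1 p) (pg _).
by rewrite bijKV.
Qed.

(** On the four states, [u] and [v] are mutually inverse 3-cycles fixing [st0], so they commute. *)
Lemma preserves_states_comm_uv :
  preserves_states [~ elt_u tau1 tau2, elt_v tau1 tau2].
Proof. by case=> [[[[[? ?] ?] ?] ?] [[] []]]. Qed.

Lemma shifts_state_subgroup : is_subgroup (fun g => exists d, shifts_state d g).
Proof.
split.
- by exists (false, false) => -[n [i j]]; rewrite /= !addbF.
- move=> g h [[i j] sg] [[k l] sh]; exists (addb i k, addb j l) => p.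
  by rewrite bijM sh sg /= !addbA.
- move=> g [[i j] sg]; exists (i, j) => p.
  by rewrite -{2 3}[p](bijKV g) sg /= !addbK -surjective_pairing.
Qed.

(** Translations of the Klein four-group N / K commute. *)
Lemma shifts_state_commg g h d d' :
  shifts_state d g -> shifts_state d' h -> preserves_states [~ g, h].
Proof.
move=> sg sh p.
have -> : [~ g, h] = (h * g)^-1 * (g * h) by rewrite /commg /conjg invgM !mulgA.
rewrite bijM -{2}[p](bijKV (h * g)); move: ((h * g)^-1 p) => q.
by rewrite !bijM sg !sh sg /= -!addbA (addbC d.1) (addbC d.2).
Qed.

Lemma shifts_state_rmul (c : bool) : shifts_state (c, ~~ c) (rmul (c, true)).
Proof. by case: c => -[n [[] []]]. Qed.

End Model.

(** * The free factor *)

Notation free2 := (free_group 'I_2).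
Definition fu : free2 := free_gen (@Ordinal 2 0 isT).
Definition fv : free2 := free_gen (@Ordinal 2 1 isT).

Lemma free2_generates : generates (fun x => x = fu \/ x = fv).
Proof.
move=> P sP AP; apply: free_group_generates => // _ [[[|[|//]] pi] ->]; apply: AP;
  by [left; congr free_gen; apply: val_inj | right; congr free_gen; apply: val_inj].
Qed.

Lemma free2_lift (G : groupType) (x y : G) :
  exists phi : ghom free2 G, phi fu = x /\ phi fv = y.
Proof.
have [phi phiE] := free_lift (fun i : 'I_2 => nth 1 [:: x; y] i).
by exists phi; rewrite !phiE /= /letter /= !mulg1.
Qed.

Definition free2_hom (G : groupType) (x y : G) : ghom free2 G := sval (cid (free2_lift x y)).
Lemma free2_homu (G : groupType) (x y : G) : free2_hom x y fu = x.
Proof. by rewrite /free2_hom; case: cid => ? []. Qed.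
Lemma free2_homv (G : groupType) (x y : G) : free2_hom x y fv = y.
Proof. by rewrite /free2_hom; case: cid => ? []. Qed.

Lemma ghom_eq (G H : groupType) (A : G -> Prop) (f g : ghom G H) :
  generates A -> (forall x, A x -> f x = g x) -> f =1 g.
Proof.
move=> genA; apply: genA; split=> [|x y fx fy|x fx].
- by rewrite !gmulf1.
- by rewrite !gmulfM fx fy.
- by rewrite !gmulfV fx.
Qed.

(* Conjugation by [s1] on [F]. *)
Definition ftau : ghom free2 free2 := free2_hom (fu * fv^-1) fu.
Definition ftauV : ghom free2 free2 := free2_hom fv (fu^-1 * fv).

Lemma ftauu : ftau fu = fu * fv^-1. Proof. exact: free2_homu. Qed.
Lemma ftauv : ftau fv = fu. Proof. exact: free2_homv. Qed.
Lemma ftauVu : ftauV fu = fv. Proof. exact: free2_homu. Qed.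
Lemma ftauVv : ftauV fv = fu^-1 * fv. Proof. exact: free2_homv. Qed.

Lemma ftauK : cancel ftau ftauV.
Proof.
apply: (ghom_eq (f := ftauV \o ftau) (g := idfun) free2_generates) => x [] -> /=.
  by rewrite ftauu gmulfM gmulfV ftauVu ftauVv invgM invgK mulVKg.
by rewrite ftauv ftauVu.
Qed.

Lemma ftauVK : cancel ftauV ftau.
Proof.
apply: (ghom_eq (f := ftau \o ftauV) (g := idfun) free2_generates) => x [] -> /=.
  by rewrite ftauVu ftauv.
by rewrite ftauVv gmulfM gmulfV ftauu ftauv invgM invgK mulgVK.
Qed.

Definition btau : bij free2 := Bij ftauK ftauVK.

Fact rtransK (x : free2) : cancel ( *%g^~ x) ( *%g^~ x^-1).
Proof. by move=> y; rewrite mulgK. Qed.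
Fact rtransVK (x : free2) : cancel ( *%g^~ x^-1) ( *%g^~ x).
Proof. by move=> y; rewrite mulgVK. Qed.
Definition rtrans (x : free2) : bij free2 := Bij (rtransK x) (rtransVK x).

(** N is to act trivially, so [s3] acts as [s1] and both braid relations become the single identity
    [e]. *)
Lemma btau_rels : braid_rels btau (rtrans fu * btau) btau.
Proof.
have e : ftau (ftau (ftau fu)) * ftau fu = ftau (ftau fu).
  by rewrite !(ftauu, ftauv, gmulfM, gmulfV, invgM, invgK) !mulgA !(mulgVK, mulgK).
split=> //; apply: bijP => x; rewrite /= !gmulfM -?mulgA ?e //.
Qed.

Lemma rho_lift : exists phi : ghom braid4 (bij free2),
  [/\ phi s1 = btau, phi s2 = rtrans fu * btau & phi s3 = btau].
Proof. exact: braid4_lift btau_rels. Qed.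

Definition rho : ghom braid4 (bij free2) := sval (cid rho_lift).
Lemma rhoE : [/\ rho s1 = btau, rho s2 = rtrans fu * btau & rho s3 = btau].
Proof. by rewrite /rho; case: cid. Qed.

Notation Ba := (elt_a s1 s3).
Notation Bb := (elt_b s1 s2 s3).
Notation Bu := (elt_u s1 s2).
Notation Bv := (elt_v s1 s2).
Notation evB := (eval (pick_gen Ba Bb)).

Definition iF : ghom free2 braid4 := free2_hom Bu Bv.
Lemma iFu : iF fu = Bu. Proof. exact: free2_homu. Qed.
Lemma iFv : iF fv = Bv. Proof. exact: free2_homv. Qed.

(** At [x = 1] this recovers [f] from its image in B_4; this is how free components are read off
    below. *)
Lemma rho_iF f x : rho (iF f) x = x * f.
Proof.
have [r1 r2 _] := rhoE.
apply: (free2_generates (P := fun f => forall x, rho (iF f) x = x * f)) => {f x}.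
  split=> [x|f g ef eg x|f ef x].
  - by rewrite !gmulf1 mulg1.
  - by rewrite !gmulfM bijM ef eg mulgA.
  - by rewrite !gmulfV; apply: (can_inj (bij_funK (rho (iF f)))); rewrite bijKV ef mulgVK.
have ru x : rho Bu x = x * fu.
  by rewrite /elt_u gmulfM gmulfV r1 r2 mulgK.
move=> f [] -> x; rewrite ?iFu // iFv /elt_v gmulfJ gmulfV r1 /conjg invgK.
rewrite -[LHS]/(ftauV (rho Bu (ftau x))) ru gmulfM ftauK ftauVu //.
Qed.

Lemma rho_evB w : rho (evB w) = 1.
Proof.
have [r1 r2 r3] := rhoE.
have ra : rho Ba = 1 by rewrite /elt_a gmulfM gmulfV r1 r3 mulgV.
apply: (@eval_mem _ _ _ w (fun g => rho g = 1)); first by case: (ker_normal rho).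
by case; rewrite /pick_gen // /elt_b gmulfJ ra conj1g.
Qed.

Definition inN (g : braid4) := exists w, g = evB w.

Lemma inN_normal : is_normal inN.
Proof.
apply: (normal_of_generators braid4_generates (eval_subgroup _)).
have H x w : inN (evB w ^ letter (pick_gen s1 s2) x).
  by rewrite (eval_braid_subst braid4_rels); exists (subst (braid_subst x) w).
have h1 w : inN (evB w ^ s1) := H la w.
have h1V w : inN (evB w ^ s1^-1) := H lA w.
have h2 w : inN (evB w ^ s2) := H lb w.
have h2V w : inN (evB w ^ s2^-1) := H lB w.
have [_ NM NV] : is_subgroup inN := eval_subgroup _.
have Na : inN Ba by exists [:: la]; rewrite /= mulg1.
have NJ g h : inN g -> inN h -> inN (g ^ h).
  by move=> Ng Nh; rewrite /conjg; apply: (NM); [exact: NV | exact: NM].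
move=> x y [] -> [w ->]; split; rewrite -/(inN _).
1-4: by [exact: h1 | exact: h1V | exact: h2 | exact: h2V].
(* The substitutions cover [s1] and [s2] only; [s3 = a * s1] reduces to [s1] and to conjugation
   inside N. *)
- have -> : evB w ^ s3 = (evB w ^ Ba) ^ s1 by rewrite -conjgM -s3_eq.
  have [w' ->] : inN (evB w ^ Ba) by apply: (NJ) => //; exists w.
  exact: h1.
- have -> : evB w ^ s3^-1 = (evB w ^ s1^-1) ^ Ba^-1.
    by rewrite -conjgM -invgM -s3_eq.
  by have [w' ->] := h1V w; apply: (NJ); [exists w' | exact: NV].
Qed.

Lemma iF_conj1 f : iF f ^ s1 = iF (ftau f).
Proof.
apply: (ghom_eq (f := conj_by s1 \o iF) (g := iF \o ftau) free2_generates) => {f} x.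
move=> [] -> /=; rewrite /conj_by.
  by rewrite iFu ftauu gmulfM gmulfV iFu iFv (conj_u1 braid4_rels).
by rewrite iFv ftauv iFu conj_v1.
Qed.

Lemma iF_conj1V f : iF f ^ s1^-1 = iF (ftauV f).
Proof. by apply: (conjg_inj s1); rewrite conjgKV iF_conj1 ftauVK. Qed.

Definition inFN (g : braid4) := exists f, exists2 n, inN n & g = iF f * n.

Lemma inFN_subgroup : is_subgroup inFN.
Proof.
have [[N1 NM NV] NJ] := inN_normal; split.
- by exists 1, 1 => //; rewrite gmulf1 mulg1.
- move=> _ _ [f [n Nn ->]] [g [m Nm ->]]; exists (f * g), (n ^ iF g * m).
    by apply: (NM) => //; apply: (NJ).
  by rewrite gmulfM /conjg !mulgA mulgK.
- move=> _ [f [n Nn ->]]; exists f^-1, (n^-1 ^ iF f^-1).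
    by apply/NJ/NV.
  by rewrite gmulfV /conjg invgK invgM !mulgA mulVg mul1g.
Qed.

Lemma inFN_F f : inFN (iF f).
Proof.
have [[N1 _ _] _] := inN_normal.
by exists f, 1 => //; rewrite mulg1.
Qed.

Lemma inFN_N n : inN n -> inFN n.
Proof. by exists 1, n; rewrite ?gmulf1 ?mul1g. Qed.

Lemma inFN_normal : is_normal inFN.
Proof.
have [_ FNM FNV] := inFN_subgroup; have [_ NJ] := inN_normal.
have FNJ g h : inFN g -> inFN h -> inFN (g ^ h).
  by move=> Fg Fh; rewrite /conjg; apply: (FNM); [exact: FNV | exact: FNM].
apply: (normal_of_generators braid4_generates inFN_subgroup).
have J1 g : inFN g -> inFN (g ^ s1) /\ inFN (g ^ s1^-1).
  move=> [f [n Nn ->]]; rewrite !conjMg iF_conj1 iF_conj1V.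
  by split; apply: (FNM); [exact: inFN_F | apply/inFN_N/NJ | exact: inFN_F | apply/inFN_N/NJ].
have Fu : inFN Bu by rewrite -iFu; exact: inFN_F.
have Fa : inFN Ba by apply: inFN_N; exists [:: la]; rewrite /= mulg1.
have J g x : inFN g -> inFN x ->
    inFN (g ^ (x * s1)) /\ inFN (g ^ (x * s1)^-1).
  move=> Fg Fx; rewrite invgM !conjgM; split.
    by apply: (J1 _ _).1; apply: (FNJ).
  by apply: (FNJ); [apply: (J1 _ _).2 | exact: FNV].
move=> g y [] -> Fg; first exact: J1.
  by have := J g Bu Fg Fu; rewrite -s2_eq.
by have := J g Ba Fg Fa; rewrite -s3_eq.
Qed.

(** All three generators lie in the coset [F N s1], so the quotient by F N is cyclic; [H] makes this
    explicit for commutators. *)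
Lemma derived1_inFN g : g \in derived_series braid4 1 -> inFN g.
Proof.
apply: (derived1_of_generators braid4_generates inFN_normal).
have [[F1 FM FV] FJ] := inFN_normal.
have H p q : inFN p -> inFN q -> inFN [~ p * s1, q * s1].
  move=> Fp Fq.
  have -> : [~ p * s1, q * s1] = p^-1 ^ s1 * (q^-1 * p) ^ (s1 * s1) * q ^ s1.
    by rewrite /commg /conjg !invgM !mulgA !mulgK.
  by apply: (FM); [apply: (FM)|]; apply: (FJ); [apply: FV | apply: (FM); [apply: FV|] |].
have Fu : inFN Bu by rewrite -iFu; exact: inFN_F.
have Fa : inFN Ba by apply: inFN_N; exists [:: la]; rewrite /= mulg1.
have gen x : [\/ x = s1, x = s2 | x = s3] -> exists2 p, inFN p & x = p * s1.
  case=> ->; first by exists 1; rewrite ?mul1g.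
    by exists Bu => //; exact: s2_eq.
  by exists Ba => //; exact: s3_eq.
by move=> x y /gen[p Fp ->] /gen[q Fq ->]; apply: H.
Qed.

(** * The derived series of B_4 *)

Section DerivedSection.
Variables (G : groupType) (n : nat).
Notation D := (derived_series G).

Definition section_hom : ghom (subgroup_type (D n)) (section_group (D n) (D n.+1)) :=
  coset (preimage (val : subgroup_type (D n) -> G) (D n.+1)).

Lemma section_proj1P x : section_proj (D n) (D n.+1) x = 1 <-> val x \in D n.+1.
Proof. exact: coset1P. Qed.

Lemma section_proj_surj y : exists x, section_proj (D n) (D n.+1) x = y.
Proof. exact: coset_surj. Qed.

(** The induction for the converse runs in [G], so it produces some lift in the commutator subgroup;
    injectivity of [val] identifies it with [x]. *)
Lemma commutator_subgroup_type (x : subgroup_type (D n)) :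
  x \in commutator (full _) (full _) <-> val x \in D n.+1.
Proof.
split; first move: x.
  apply: generated_ind; first exact: (preim_subgroup val (subgroup_gpred _)).
  by move=> _ [x [y [_ _ ->]]]; rewrite gmulfR; apply: derivedR; apply: valP.
have sC := subgroup_gpred (commutator (full (subgroup_type (D n))) (full _)).
suff H z : z \in D n.+1 -> exists2 x : subgroup_type (D n),
    x \in commutator (full _) (full _) & val x = z.
  by move=> /H[y yC /val_inj <-].
move: z; apply: derived_ind.
  have [C1 CM CV] := sC; split.
  - by exists 1; [exact: C1 | exact: gmulf1].
  - move=> _ _ [y yC <-] [z zC <-]; exists (y * z); first exact: CM.
    exact: gmulfM.
  - by move=> _ [y yC <-]; exists y^-1; [exact: CV | exact: gmulfV].
move=> y z yn zn; exists [~ (Sub y yn : subgroup_type (D n)), Sub z zn].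
  by apply: mem_generated; do 2!eexists.
exact: gmulfR.
Qed.

Lemma abelianization_section :
  exists f : {multiplicative abelianization (subgroup_type (D n))
                             -> section_group (D n) (D n.+1)},
    bijective f /\
    forall x, f (abelianization_proj x) = section_proj (D n) (D n.+1) x.
Proof.
apply: (first_isomorphism (phi := section_hom)); last exact: coset_surj.
by move=> x; rewrite commutator_subgroup_type; exact: section_proj1P.
Qed.

End DerivedSection.

(* On [B_4'] the action [rho] is by right translations, through the projection
   of [F N] onto [F]. *)
Definition rho_trans n (g : braid4) :=
  exists2 f, f \in derived_series free2 n & forall x, rho g x = x * f.

Lemma rho_trans_subgroup n : is_subgroup (rho_trans n).
Proof.
split=> [|g h [f fn fE] [k kn kE]|g [f fn fE]].
- by exists 1 => [|x]; rewrite ?gpred1 // gmulf1 mulg1.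
- by exists (f * k) => [|x]; rewrite ?gpredM // gmulfM bijM fE kE mulgA.
- exists f^-1 => [|x]; rewrite ?gpredV // gmulfV.
  by apply: (can_inj (bij_funK (rho g))); rewrite bijKV fE mulgVK.
Qed.

Lemma rho_trans1 f w x : rho (iF f * evB w) x = x * f.
Proof. by rewrite gmulfM rho_evB mulg1 rho_iF. Qed.

Lemma rho_derived n g : g \in derived_series braid4 n.+1 -> rho_trans n g.
Proof.
elim: n g => [|n IHn] g.
  by move=> /derived1_inFN[f [_ [w ->] ->]]; exists f => // x; rewrite rho_trans1.
move: g; apply: derived_ind; first exact: rho_trans_subgroup.
move=> g h /IHn[f fn fE] /IHn[k kn kE]; exists [~ f, k]; first exact: derivedR.
have e p q : rho p =1 *%g^~ q -> rho p = rtrans q by move=> H; apply: bijP.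
move=> x; rewrite gmulfR (e _ _ fE) (e _ _ kE) -[LHS]/(x * f^-1 * k^-1 * f * k).
by rewrite /commg /conjg !mulgA.
Qed.

(** The free component is the image of 1 under [rho g], which [rho_derived] places in the derived
    series of F. *)
Lemma derived_decomp n g : g \in derived_series braid4 n.+1 ->
  exists f w, f \in derived_series free2 n /\ g = iF f * evB w.
Proof.
move=> gn; have [f fn fE] := rho_derived gn.
have /derived1_inFN[k [_ [w ->] e]] : g \in derived_series braid4 1.
  exact: (derived_anti _ gn).
exists k, w; split=> //.
by have := fE 1; rewrite e rho_trans1 !mul1g => ->.
Qed.

(** The braid relation says that [(y * z) * y * (y * z)^-1 = z], so [y] and [z] agree modulo
    commutators. *)
Lemma braid_commg (G : groupType) (y z : G) : y * z * y = z * y * z ->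
  z * y^-1 = [~ y, (y * z)^-1] ^ y^-1.
Proof.
move=> e; rewrite /commg /conjg !invgK -(mulgA y^-1) mulVKg.
by rewrite (invgM y z) !mulgA e !mulgK.
Qed.

Lemma u_derived1 : Bu \in derived_series braid4 1.
Proof.
have [_ e _] := braid4_rels; rewrite /elt_u (braid_commg e).
by apply/gpredJr/derivedR.
Qed.

Lemma v_derived1 : Bv \in derived_series braid4 1.
Proof. by apply/gpredJr/u_derived1. Qed.

Lemma a_derived1 : Ba \in derived_series braid4 1.
Proof.
have [_ _ e] := braid4_rels.
have -> : Ba = (s3 * s2^-1) * Bu by rewrite /elt_a /elt_u mulgA mulgVK.
rewrite gpredM ?u_derived1 // (braid_commg e).
by apply/gpredJr/derivedR.
Qed.

Lemma iF_derived n f : f \in derived_series free2 n -> iF f \in derived_series braid4 n.+1.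
Proof.
move=> fn; rewrite -[n.+1]add1n; apply: derived_hom fn => {}f; move: f.
apply: (free2_generates (preim_subgroup iF (subgroup_gpred _))) => x [] ->.
  by rewrite iFu u_derived1.
by rewrite iFv v_derived1.
Qed.

(** * Elements of N deep in the derived series *)

Lemma evB_conj_u w : evB w ^ Bu = evB (braid_act wu w).
Proof. by rewrite -(eval_braid_act braid4_rels) eval_wu. Qed.

Lemma evB_conj_v w : evB w ^ Bv = evB (braid_act wv w).
Proof. by rewrite -(eval_braid_act braid4_rels) eval_wv. Qed.

(* Modulo [B_4''], conjugation by [u] fixes [a] and [b], but it maps [b] to [a]
   and [a] to [a b^-1 a a]. *)
Lemma a_derived2 : Ba \in derived_series braid4 2.
Proof.
have a1 := a_derived1; have b1 : Bb \in derived_series braid4 1 by exact: gpredJr.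
have := derivedR b1 u_derived1; have := derivedR a1 u_derived1.
have au : Ba ^ Bu = Ba * (Bb^-1 * (Ba * Ba)).
  by rewrite -[Ba in LHS]mulg1 -[Ba * 1]/(evB [:: la]) evB_conj_u /= mulg1.
have bu : Bb ^ Bu = Ba.
  by rewrite -[Bb in LHS]mulg1 -[Bb * 1]/(evB [:: lb]) evB_conj_u /= mulg1.
rewrite /commg au bu mulKg => h k.
by move: h; rewrite mulgA (gpredMl _ k).
Qed.

Lemma b_derived2 : Bb \in derived_series braid4 2.
Proof. exact/gpredJr/a_derived2. Qed.

Section AbelianEval.
Variables (G : groupType) (x y : G).
Hypothesis xy : commute x y.

Definition exponent_sum (w : word bool) (c : bool) : int :=
  foldr (fun z n => if z.1 == c then (if z.2 then 1 else -1) + n else n)%R 0%R w.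

Lemma eval_abelian w : eval (pick_gen x y) w =
  zexp x (exponent_sum w true) * zexp y (exponent_sum w false).
Proof.
have C (m : int) k : commute (zexp x m) (zexp y k) by exact: commute_zexp2.
elim: w => [|[c e] w IHw] /=; first by rewrite mulg1.
rewrite IHw; case: c; first by case: e; rewrite /letter /= zexpD ?zexp1 ?zexpN1 mulgA.
rewrite zexpD mulgA [RHS]mulgA C -!mulgA; congr (_ * _).
  by case: e.
Qed.
End AbelianEval.

(* Modulo [B_4'''], conjugation by [u v] and by [v u] agree on [a] and [b], which
   commute; comparing exponents gives [a^4 = b^2] and [a^10 = b^4]. *)
Lemma a2_derived3 : Ba * Ba \in derived_series braid4 3.
Proof.
pose pi : ghom braid4 _ := coset (derived_series braid4 3); pose x := pi Ba; pose y := pi Bb.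
have xy : commute x y.
  apply/commgP; rewrite -gmulfR; apply/eqP/coset1P.
  by apply: derivedR; [exact: a_derived2 | exact: b_derived2].
(* The products [u * v] and [v * u] differ by an element of B_4'', which centralizes B_4'' modulo
   B_4'''. *)
have conj_uv g : g \in derived_series braid4 2 -> pi (g ^ (Bu * Bv)) = pi (g ^ (Bv * Bu)).
  move=> g2; have c2 : [~ Bu, Bv] \in derived_series braid4 2.
    by apply: derivedR; [exact: u_derived1 | exact: v_derived1].
  have -> : Bu * Bv = Bv * Bu * [~ Bu, Bv] by rewrite -commgC.
  rewrite (conjgM g) gmulfJ; apply/conjg_fixP; rewrite -gmulfR.
  by apply/eqP/coset1P/derivedR => //; apply: gpredJr.
have m w : pi (evB w) = zexp x (exponent_sum w true) * zexp y (exponent_sum w false).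
  by rewrite hom_eval -(eval_abelian xy); apply: eval_ext; case.
have kill w : evB w \in derived_series braid4 2 ->
    let s := exponent_sum (braid_act wv (braid_act wu w)) in
    let t := exponent_sum (braid_act wu (braid_act wv w)) in
    zexp x (t true - s true)%R * zexp y (t false - s false)%R = 1.
  move=> w2 s t; have := conj_uv _ w2.
  rewrite (conjgM _ Bu Bv) (conjgM _ Bv Bu) evB_conj_u 2!evB_conj_v evB_conj_u !m -/s -/t => e.
  rewrite addrC !zexpD !zexpN -mulgA (mulgA (zexp x (t true))) -e.
  by rewrite mulgA mulKg mulgV.
have ea : evB [:: la] = Ba by rewrite /= mulg1.
have eb : evB [:: lb] = Bb by rewrite /= mulg1.
have k1 : zexp x 4 * zexp y (-2)%R = 1.
  by apply: (kill [:: la]); rewrite ea; exact: a_derived2.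
have k2 : zexp x 10 * zexp y (-4)%R = 1.
  by apply: (kill [:: lb]); rewrite eb; exact: b_derived2.
apply/coset1P; rewrite -[LHS]/(pi (Ba * Ba)) gmulfM.
(* Each factor [x^-4] is replaced by [y^-2], which leaves the relation [k2]. *)
rewrite -[LHS]/(zexp x ((10 - 4) - 4)%R).
have e4 : zexp y (-2)%R = zexp x (- 4)%R by rewrite zexpN -[RHS]mulg1 -k1 mulKg.
rewrite zexpD (zexpD x 10) -mulgA -e4 -zexpD.
by rewrite [LHS]k2.
Qed.

Lemma b2_derived3 : Bb * Bb \in derived_series braid4 3.
Proof. by rewrite /elt_b -conjMg; apply/gpredJr/a2_derived3. Qed.

Notation basisB := [:: evB wh1; evB wh2; evB wh3; evB wy1; evB wy2].

Lemma basis_derived3 : {in basisB, forall x, x \in derived_series braid4 3}.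
Proof.
have a2 := a2_derived3; have b2 := b2_derived3.
have aR : [~ Bb^-1, Ba^-1] \in derived_series braid4 3.
  by apply: derivedR; rewrite gpredV ?a_derived2 ?b_derived2.
move=> x; rewrite !inE => /or4P[/eqP->|/eqP->|/eqP->|/orP[]/eqP->].
- by rewrite /= mulg1.
- by rewrite /= mulg1.
- by move: aR; rewrite /commg /conjg !invgK /= mulg1.
- have -> : evB wy1 = (Ba * Ba) * (Ba * Ba) ^ Bb^-1.
    by rewrite /conjg invgK /= mulg1 -!(mulgA Ba).
  by rewrite gpredM // gpredJr.
- have -> : evB wy2 = (Bb * Bb) * (Bb * Bb) ^ Ba^-1.
    by rewrite /conjg invgK /= mulg1 -!(mulgA Bb).
  by rewrite gpredM // gpredJr.
Qed.

(** * Relations in B_4 / B_4'''' *)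

Definition mod4 : ghom braid4 (quotient_group (derived_series braid4 4)) :=
  coset (derived_series braid4 4).

Lemma mod4_commute x y : x \in derived_series braid4 3 -> y \in derived_series braid4 3 ->
  commute (mod4 x) (mod4 y).
Proof.
move=> x3 y3; apply/commgP; rewrite -gmulfR; apply/eqP/coset1P.
exact: derivedR.
Qed.

Notation evQ := (eval (pick_gen (mod4 Ba) (mod4 Bb))).
Notation basisQ := [:: evQ wh1; evQ wh2; evQ wh3; evQ wy1; evQ wy2].

Lemma mod4_eval w : mod4 (evB w) = evQ w.
Proof. by rewrite hom_eval; apply: eval_ext; case. Qed.

Lemma basis_commute : {in basisQ &, forall x y, commute x y}.
Proof.
have H x : x \in basisQ -> exists2 y, y \in derived_series braid4 3 & x = mod4 y.
  rewrite -!mod4_eval !inE => /or4P[/eqP->|/eqP->|/eqP->|/orP[]/eqP->];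
  by eexists; last reflexivity; apply: basis_derived3; rewrite !inE eqxx ?orbT.
by move=> x y /H[x' x3 ->] /H[y' y3 ->]; exact: mod4_commute.
Qed.

Notation xpowQ := (xpow (mod4 Ba) (mod4 Bb)).

Definition wc1 : word bool := word_inv wu ++ word_inv wv ++ wu ++ wv.
Definition wc2 : word bool := wu ++ wc1 ++ word_inv wu.

Lemma eval_wc1 : eval (pick_gen s1 s2) wc1 = [~ Bu, Bv].
Proof.
by rewrite /wc1 !eval_cat !eval_inv eval_wu eval_wv /commg /conjg.
Qed.

Lemma eval_wc2 : eval (pick_gen s1 s2) wc2 = [~ Bu, Bv] ^ Bu^-1.
Proof.
by rewrite /wc2 eval_cat (eval_cat _ wc1) eval_inv eval_wc1 eval_wu [RHS]/conjg invgK.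
Qed.

(** [u, v] and its conjugate by [u^-1] lie in B_4'', so their commutator lies in B_4''' and acts
    trivially on B_4''' / B_4''''. *)
Lemma wc_commute w : evB w \in derived_series braid4 3 ->
  evQ (braid_act (wc1 ++ wc2) w) = evQ (braid_act (wc2 ++ wc1) w).
Proof.
move=> w3; set c1 := [~ Bu, Bv].
have c12 : c1 \in derived_series braid4 2.
  by apply: derivedR; [exact: u_derived1 | exact: v_derived1].
have c3 : [~ c1, c1 ^ Bu^-1] \in derived_series braid4 3.
  by apply: derivedR => //; apply: gpredJr.
rewrite -!mod4_eval -!(eval_braid_act braid4_rels).
rewrite (eval_cat _ wc1 wc2) (eval_cat _ wc2 wc1) eval_wc1 eval_wc2 -/c1.
rewrite (commgC c1) (conjgM _ (_ * c1)) [LHS]gmulfJ; apply/conjg_fixP/commgP.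
by apply: mod4_commute => //; apply: gpredJr.
Qed.

(* [wh1] and [wh2] yield [y1^18 = 1] and [y1^108 = y2^18] respectively. *)
Lemma y18 : zexp (evQ wy1) 18 = 1 /\ zexp (evQ wy2) 18 = 1.
Proof.
have C := basis_commute.
(* Both runs end in [st0], so the representative cancels and the difference of the two exponents is
   a relation. *)
have K w : evB w \in basisB -> (run (braid_act (wc1 ++ wc2) w) st0).2 = st0 ->
    (run (braid_act (wc2 ++ wc1) w) st0).2 = st0 ->
    xpowQ ((run (braid_act (wc2 ++ wc1) w) st0).1
           - (run (braid_act (wc1 ++ wc2) w) st0).1)%R = 1.
  move=> /basis_derived3/wc_commute; rewrite 2!(eval_run C) => e e1 e2.
  move: e; rewrite e1 e2 => /mulIg e.
  by rewrite /xpow (zpow5D C) (zpow5N C) -![zpow5 _ _ _ _ _ _]/(xpowQ _) e mulgV.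
have h1 : zexp (evQ wy1) 18 = 1.
  have := @K wh1; rewrite mem_head => /(_ isT).
  set r1 := run _ _; set r2 := run _ _.
  have -> : r1 = (mkZ5 1 0 0 (-9) (-3), st0) by vm_compute.
  have -> : r2 = (mkZ5 1 0 0 9 (-3), st0) by vm_compute.
  move=> /(_ erefl erefl); rewrite -[(_ - _)%R]/(mkZ5 0 0 0 18 0) [xpow _ _ _]zpow5_y.
  by rewrite mulg1.
split; first exact: h1.
have := @K wh2; rewrite in_cons mem_head orbT => /(_ isT).
set r1 := run _ _; set r2 := run _ _.
have -> : (r2.1 - r1.1 = mkZ5 0 0 0 108 (-18))%R by vm_compute.
have -> : r1.2 = st0 by vm_compute.
have -> : r2.2 = st0 by vm_compute.
move=> /(_ erefl erefl); rewrite [xpow _ _ _]zpow5_y.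
have -> : zexp (evQ wy1) 108%R = 1.
  by rewrite -[LHS]/(zexp (evQ wy1) (18 * 6)%R) zexpM h1; exact: expg1n.
rewrite mul1g zexpN.
by move=> e; apply: invg_inj; rewrite invg1 -[RHS]e.
Qed.

(** * The translation invariant of B_4''' *)

Notation A18 := (modA 'Z_18).

Lemma Z18_char : (18%:R = 0 :> 'Z_18)%R. Proof. by apply/val_inj. Qed.

Lemma Z18_surj (y : 'Z_18) : exists k : int, (k%:~R = y :> 'Z_18)%R.
Proof. by exists (y : nat); rewrite -[LHS]/((y : nat)%:R)%R natr_Zp. Qed.

Lemma Z18_eq0 (k : int) : (k%:~R = 0 :> 'Z_18)%R -> exists q, k = (18 * q)%R.
Proof.
have H (j : nat) : (j%:R = 0 :> 'Z_18)%R -> exists q, Posz j = (18 * q)%R.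
  move=> /(congr1 val); rewrite /= val_Zp_nat // => /eqP/dvdnP[q ->].
  by exists q; rewrite mulnC PoszM.
case: k => j; first exact: H.
rewrite NegzE mulrNz => /eqP; rewrite oppr_eq0 => /eqP/H[q ->].
by exists (- q)%R; rewrite mulrN.
Qed.

Lemma castA_surj (n : A18) : exists m, castA 'Z_18 m = n.
Proof.
case: n => [[[[h1 h2] h3] y1] y2].
have [k1 <-] := Z18_surj y1; have [k2 <-] := Z18_surj y2.
by exists (mkZ5 h1 h2 h3 k1 k2).
Qed.

(** By [y18], the model loses nothing: an exponent that vanishes in [A18] is already trivial modulo
    B_4''''. *)
Lemma xpowQ_ker n : castA 'Z_18 n = 0%R -> xpowQ n = 1.
Proof.
case: n => [[[[h1 h2] h3] y1] y2] [-> -> -> /Z18_eq0[q1 ->] /Z18_eq0[q2 ->]].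
have [e1 e2] := y18.
by rewrite [LHS]zpow5_y 2!zexpM e1 e2 2!zexp1g mulg1.
Qed.

Definition model : ghom braid4 (bij (point 'Z_18)) := sval (cid (model_hom 'Z_18)).

Lemma modelE : [/\ model s1 = tau1 _, model s2 = tau2 _,
  model Ba = rmul _ la & model Bb = rmul _ lb].
Proof. by rewrite /model; case: cid. Qed.

Lemma model_u : model Bu = elt_u (tau1 _) (tau2 _).
Proof. by have [e1 e2 _ _] := modelE; rewrite /elt_u gmulfM gmulfV e1 e2. Qed.

Lemma model_v : model Bv = elt_v (tau1 _) (tau2 _).
Proof.
by have [e1 _ _ _] := modelE; rewrite /elt_v gmulfJ gmulfV model_u e1.
Qed.

Lemma model_evB w : model (evB w) = eval (pick_gen (rmul _ la) (rmul _ lb)) w.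
Proof.
by have [_ _ ea eb] := modelE; rewrite hom_eval; apply: eval_ext => -[].
Qed.

Lemma model_state_compatible g : state_compatible (model g).
Proof.
have [e1 e2 ea _] := modelE.
have sC := state_compatible_subgroup 'Z_18; have [_ CM _] := sC.
apply: (braid4_generates (preim_subgroup model sC)) => x [] ->.
- by rewrite e1; exact: state_compatible_tau1.
- by rewrite e2; exact: state_compatible_tau2.
- rewrite (s3_eq s1 s3) gmulfM ea e1.
  by apply: CM; [exact: state_compatible_rmul | exact: state_compatible_tau1].
Qed.

Lemma free2_derived1_ind (P : free2 -> Prop) : is_normal P -> P [~ fu, fv] ->
  forall f, f \in derived_series free2 1 -> P f.
Proof.
move=> nP Puv; have [[P1 _ PV] _] := nP.
apply: (derived1_of_generators free2_generates nP) => x y [] -> [] -> //;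
  by rewrite ?commgg // -invgR; apply: PV.
Qed.

(** The normalizer of the group [twists_fibre] contains [tau1] and [tau2], hence [u] and [v], and F'
    is the normal closure of [u, v]. *)
Lemma twists_fibre_derived1 f : f \in derived_series free2 1 -> twists_fibre (model (iF f)).
Proof.
have [e1 e2 _ _] := modelE; have sU := twists_fibre_subgroup Z18_char.
pose N (g : bij (point 'Z_18)) :=
  forall h, twists_fibre h -> twists_fibre (h ^ g) /\ twists_fibre (h ^ g^-1).
have [_ NM NV] : is_subgroup N := normalizer_subgroup sU.
have N1 : N (tau1 _) := @twists_fibre_conj_tau1 _.
have N2 : N (tau2 _) := @twists_fibre_conj_tau2 _.
have Nu : N (model Bu) by rewrite model_u; apply: (NM) => //; apply: (NV).
have Nv : N (model Bv).
  rewrite model_v /elt_v /conjg invgK -model_u.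
  by apply: (NM) => //; apply: (NM) => //; apply: (NV).
apply: (@free2_derived1_ind (fun x => twists_fibre (model (iF x)))); last first.
  by rewrite !gmulfR iFu iFv model_u model_v; exact: twists_fibre_comm_uv.
apply: (normal_of_generators free2_generates).
  exact: (preim_subgroup iF (preim_subgroup model sU)).
move=> x y [] -> Ux; rewrite !gmulfJ !gmulfV ?iFu ?iFv; first exact: Nu.
exact: Nv.
Qed.

(** The maps induced by F' on the fibre commute modulo 18. *)
Lemma model_fixes_fibre f n : f \in derived_series free2 2 ->
  model (iF f) (n, st0) = (n, st0).
Proof.
move=> f2; move: f f2 n; apply: derived_ind.
  split=> [n|x y fx fy n|x fx n].
  - by rewrite !gmulf1.
  - by rewrite !gmulfM bijM fx fy.
  - by rewrite !gmulfV -{1}(fx n) bijVK.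
move=> x y x1 y1 n; rewrite !gmulfR.
by apply: (twists_fibre_commg Z18_char); apply: twists_fibre_derived1.
Qed.

Lemma preserves_derived1 f : f \in derived_series free2 1 ->
  preserves_states (model (iF f)).
Proof.
apply: (@free2_derived1_ind (fun x => preserves_states (model (iF x)))); last first.
  by rewrite !gmulfR iFu iFv model_u model_v; exact: preserves_states_comm_uv.
have sP := preserves_states_subgroup 'Z_18.
split; first exact: (preim_subgroup iF (preim_subgroup model sP)).
move=> x y Px; rewrite !gmulfJ; apply: preserves_states_conj => //.
exact: model_state_compatible.
Qed.

(** B_4'' lies in F' N, where F' fixes every state and N translates them. *)
Lemma shifts_derived2 g : g \in derived_series braid4 2 ->
  exists d, shifts_state d (model g).
Proof.
move=> /derived_decomp[f [w [f1 ->]]]; rewrite gmulfM.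
have sS := shifts_state_subgroup 'Z_18; have [_ SM _] := sS.
apply: (SM).
  by exists st0 => p; rewrite preserves_derived1 // !addbF -surjective_pairing.
rewrite model_evB; apply: (eval_mem _ sS) => c.
by case: c; eexists; exact: shifts_state_rmul.
Qed.

Lemma preserves_derived3 g : g \in derived_series braid4 3 -> preserves_states (model g).
Proof.
move: g; apply: derived_ind.
  exact: (preim_subgroup model (preserves_states_subgroup _)).
move=> x y /shifts_derived2[d dE] /shifts_derived2[d' d'E]; rewrite gmulfR.
exact: shifts_state_commg dE d'E.
Qed.

(** [iF f] fixes the fibre pointwise and the product preserves states, so the run of [w] returns to
    [st0]: the N-part lies in K. *)
Lemma model_decomp f w n : f \in derived_series free2 2 ->
  iF f * evB w \in derived_series braid4 3 ->
  (run w st0).2 = st0 /\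
  model (iF f * evB w) (n, st0) = ((n + castA 'Z_18 (run w st0).1)%R, st0).
Proof.
move=> f2 g3; have := preserves_derived3 g3 (n, st0).
rewrite gmulfM bijM model_fixes_fibre // model_evB eval_rmul.
by case: (run w st0) => m t /= ->.
Qed.

(** The image of the origin is recorded because B_4''' acts on the fibre by translations, which it
    determines. *)
Definition theta (g : braid4) : A18 := (model g (0%R, st0)).1.

Lemma model_translation g n : g \in derived_series braid4 3 ->
  model g (n, st0) = ((n + theta g)%R, st0).
Proof.
move=> g3; have [f [w [f2 e]]] := derived_decomp g3; rewrite e in g3 *.
have [_ e1] := model_decomp n f2 g3; have [_ e2] := model_decomp 0%R f2 g3.
by rewrite /theta e2 e1 add0r.
Qed.

Lemma thetaM g h : g \in derived_series braid4 3 -> h \in derived_series braid4 3 ->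
  theta (g * h) = (theta g + theta h)%R.
Proof.
by move=> g3 h3; rewrite {1}/theta gmulfM bijM !model_translation // add0r.
Qed.

Lemma theta_derived4 g : g \in derived_series braid4 4 -> theta g = 0%R.
Proof.
(* Membership in B_4''' is carried through the induction, since additivity of [theta] is available
   only there. *)
move=> g4; suff [] : g \in derived_series braid4 3 /\ theta g = 0%R by [].
move: g g4; apply: derived_ind.
  have t1 : theta 1 = 0%R by rewrite /theta gmulf1.
  split=> [|x y [x3 ex] [y3 ey]|x [x3 ex]].
  - by rewrite gpred1.
  - by rewrite gpredM // thetaM // ex ey addr0.
  - rewrite gpredV; split=> //; apply: (addrI (theta x)).
    by rewrite -thetaM ?gpredV // mulgV t1 ex addr0.
move=> x y x3 y3; have r3 : [~ x, y] \in derived_series braid4 3.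
  exact/derived_series_sub/derivedR.
split=> //; apply: (addrI (theta (y * x))).
have yx3 : y * x \in derived_series braid4 3 by rewrite gpredM.
by rewrite -(thetaM yx3 r3) -(commgC x) !thetaM // addr0 addrC.
Qed.

(** The two detectors suffice: [rho] puts the free component in F''', and [theta] makes the
    N-component trivial by [xpowQ_ker]. *)
Lemma theta_ker g : g \in derived_series braid4 3 -> theta g = 0%R ->
  rho_trans 3 g -> g \in derived_series braid4 4.
Proof.
move=> g3 tg [k k3 kE]; have [f [w [f2 e]]] := derived_decomp g3.
have fk : f = k by have := kE 1; rewrite e rho_trans1 !mul1g.
rewrite e in g3 tg *; have [r0 rE] := model_decomp 0%R f2 g3.
rewrite gpredM //; first by apply: iF_derived; rewrite fk.
apply/coset1P; rewrite -[LHS]/(mod4 (evB w)) mod4_eval (eval_run basis_commute) r0.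
rewrite xpowQ_ker; first by rewrite /rep /= !mulg1.
by move: tg; rewrite /theta rE add0r.
Qed.

Lemma theta_surj (n : A18) :
  exists g, [/\ g \in derived_series braid4 3, rho g = 1 & theta g = n].
Proof.
have [m <-] := castA_surj n.
have bD := basis_derived3.
(* Requiring [rho g = 1] lets the two coordinates of the final map be prescribed independently. *)
pose P (k : Z5) (g : braid4) :=
  [/\ g \in derived_series braid4 3, rho g = 1 & theta g = castA 'Z_18 k].
have PM k l g h : P k g -> P l h -> P (k + l)%R (g * h).
  move=> [g3 rg tg] [h3 rh th]; split; first by rewrite gpredM.
    by rewrite gmulfM rg rh mulg1.
  by rewrite thetaM // tg th castAD.
have PV k g : P k g -> P (- k)%R g^-1.
  move=> [g3 rg tg]; split; first by rewrite gpredV.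
    by rewrite gmulfV rg invg1.
  apply: (addrI (theta g)); rewrite -thetaM ?gpredV // mulgV tg -castAD subrr castA0.
  by rewrite /theta gmulf1.
have Pe w k : evB w \in basisB -> run w st0 = (k, st0) -> P k (evB w).
  move=> wb rw; split; [exact: bD | exact: rho_evB |].
  by rewrite /theta model_evB eval_rmul /= rw add0r.
have P0 : P 0%R 1.
  by split; rewrite ?gpred1 ?gmulf1 // /theta gmulf1 castA0.
(* [L] parametrizes a coordinate axis of Z^5; its additivity is asked only for the unit steps of the
   induction on integers. *)
have Pz (L : int -> Z5) g j : L 0%R = 0%R ->
    (forall i, L (1 + i) = L 1 + L i)%R -> (forall i, L (- 1 + i) = - L 1 + L i)%R ->
    P (L 1%R) g -> P (L j) (zexp g j).
  move=> L0 LD LN Pg; elim/int_rec: j => [|j IHj|j IHj]; first by rewrite L0.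
    by rewrite intS LD zexp_succ; apply: (PM).
  by rewrite intS opprD LN zexp_pred; apply: (PM) => //; apply: (PV).
case: m => [[[[m1 m2] m3] m4] m5].
exists (zexp (evB wh1) m1 * zexp (evB wh2) m2 * zexp (evB wh3) m3 * zexp (evB wy1) m4
  * zexp (evB wy2) m5).
have -> : (m1, m2, m3, m4, m5) = (mkZ5 m1 0 0 0 0 + mkZ5 0 m2 0 0 0
    + mkZ5 0 0 m3 0 0 + mkZ5 0 0 0 m4 0 + mkZ5 0 0 0 0 m5)%R :> Z5.
  by do ?congr (_, _); rewrite /= ?addr0 ?add0r.
have p1 : P (mkZ5 m1 0 0 0 0) (zexp (evB wh1) m1).
  apply: (Pz (fun j => mkZ5 j 0 0 0 0)) => //.
  by apply: Pe; rewrite ?inE ?eqxx ?orbT.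
have p2 : P (mkZ5 0 m2 0 0 0) (zexp (evB wh2) m2).
  apply: (Pz (fun j => mkZ5 0 j 0 0 0)) => //.
  by apply: Pe; rewrite ?inE ?eqxx ?orbT.
have p3 : P (mkZ5 0 0 m3 0 0) (zexp (evB wh3) m3).
  apply: (Pz (fun j => mkZ5 0 0 j 0 0)) => //.
  by apply: Pe; rewrite ?inE ?eqxx ?orbT.
have p4 : P (mkZ5 0 0 0 m4 0) (zexp (evB wy1) m4).
  apply: (Pz (fun j => mkZ5 0 0 0 j 0)) => //.
  by apply: Pe; rewrite ?inE ?eqxx ?orbT.
have p5 : P (mkZ5 0 0 0 0 m5) (zexp (evB wy2) m5).
  apply: (Pz (fun j => mkZ5 0 0 0 0 j)) => //.
  by apply: Pe; rewrite ?inE ?eqxx ?orbT.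
exact: (PM _ _ _ _ (PM _ _ _ _ (PM _ _ _ _ (PM _ _ _ _ p1 p2) p3) p4) p5).
Qed.

(** * Assembling the isomorphism *)

Lemma rho1_derived2 (x : subgroup_type (derived_series braid4 3)) :
  rho (val x) 1 \in derived_series free2 2.
Proof. by have [f f2 ->] := rho_derived (valP x); rewrite mul1g. Qed.

Definition free_part (x : subgroup_type (derived_series braid4 3)) :
  subgroup_type (derived_series free2 2) := exist _ (rho (val x) 1) (rho1_derived2 x).

Lemma free_partM : {morph free_part : x y / x * y}.
Proof.
move=> x y; apply: val_inj; rewrite gmulfM /=.
have [f _ fE] := rho_derived (valP x); have [k _ kE] := rho_derived (valP y).
by rewrite !gmulfM bijM !kE !fE !mul1g.
Qed.

Definition target : groupType :=
  (Algebra.to_multiplicative int * Algebra.to_multiplicative int * Algebra.to_multiplicative int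
   * Algebra.to_multiplicative 'Z_18 * Algebra.to_multiplicative 'Z_18
   * section_group (derived_series free2 2) (derived_series free2 3))%type.

Definition target_map (x : subgroup_type (derived_series braid4 3)) : target :=
  (theta (val x),
   section_proj (derived_series free2 2) (derived_series free2 3) (free_part x)).

Lemma target_mapM : {morph target_map : x y / x * y}.
Proof.
move=> x y; rewrite /target_map free_partM [val _]gmulfM thetaM ?(valP x) ?(valP y) //.
by rewrite -[section_proj _ _]/(@section_hom free2 2 : _ -> _) gmulfM.
Qed.

Theorem proposition8 :
  let B4 := braid_group 4 in
  let F2 : groupType := free_group 'I_2 in
  let B4_3 := derived_series B4 3 in
  let B4_4 := derived_series B4 4 in
  (exists f : {multiplicative abelianization (subgroup_type B4_3)
                            -> section_group B4_3 B4_4},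
     bijective f /\
     forall x : subgroup_type B4_3,
       f (abelianization_proj x) = section_proj B4_3 B4_4 x)
  /\
  isomorphic (section_group B4_3 B4_4)
    (Algebra.to_multiplicative int * Algebra.to_multiplicative int * Algebra.to_multiplicative int
     * Algebra.to_multiplicative 'Z_18 * Algebra.to_multiplicative 'Z_18
     * section_group (derived_series F2 2) (derived_series F2 3))%type.
Proof.
split; first exact: (@abelianization_section (braid_group 4) 3).
have [phi phiE] := hom_of_morph target_mapM.
have [||f [fbij _]] := first_isomorphism
  (N := preimage (val : subgroup_type (derived_series (braid_group 4) 3) -> _)
          (derived_series (braid_group 4) 4)) (phi := phi).
(* Kernel: the two coordinates vanish together exactly on B_4''''. *)
- move=> x; rewrite phiE; split=> [e|x4].
    have e1 : theta (val x) = 0%R := congr1 fst e.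
    have /section_proj1P k3 := congr1 snd e.
    apply: theta_ker => //; first exact: valP.
    have [k _ kE] := rho_derived (valP x); exists k => //.
    by move: k3; rewrite /= kE mul1g.
  congr (_, _); first exact: theta_derived4.
  apply/section_proj1P; rewrite /=.
  by have [f f3 ->] := @rho_derived 3 (val x) x4; rewrite mul1g.
(* Surjectivity: the preimage is a product of an element of F'', which has [theta] zero, and one
   with trivial [rho]. *)
- move=> [n s]; have [t <-] := section_proj_surj s.
  have [g [g3 rg tg]] := theta_surj n.
  have x3 : iF (val t) * g \in derived_series braid4 3.
    by rewrite gpredM // iF_derived // (valP t).
  exists (exist (fun x : braid4 => x \in derived_series braid4 3) _ x3).
  rewrite phiE; congr (_, _).
    have iF3 : iF (val t) \in derived_series braid4 3 by rewrite iF_derived // (valP t).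
    rewrite /= thetaM // tg /theta model_fixes_fibre ?add0r //; exact: valP.
  congr section_proj; apply: val_inj => /=.
  by rewrite gmulfM rg mulg1 rho_iF mul1g.
by exists f.
Qed.
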